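(* Let $\lambda$ be a partition of $n$, and let $\mathcal P=\mathrm{id}+\sum_{i=1}^{n-2}\big((i,n-1,n)+(i,n,n-1)\big)\in\mathbb C[A_n]$, acting on $\mathbb C[A_n]$ by multiplication on the right. For each $T_\alpha\in\mathrm{UStd}(\lambda)\cup\mathrm{UStd}(\lambda')$, write $\alpha=(a_1,\dots,a_n):=(c(T_\alpha,1),\dots,c(T_\alpha,n))$. Then each such $T_\alpha$ provides an eigenvalue of $\mathcal P$, given as follows: (1) $2a_n-1$ is an eigenvalue of $\mathcal P$, if $a_n=a_{n-1}+1$. (2) $-(2a_n+1)$ is an eigenvalue of $\mathcal P$, if $a_n=a_{n-1}-1$. (3) $\pm(a_n+a_{n-1})$ are eigenvalues of $\mathcal P$, if $a_n\neq a_{n-1}\pm1$ and $a_{n-1}<a_n$. Moreover, each eigenvalue has multiplicity $d_\lambda:=|\mathrm{Std}(\lambda)|$.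
   Context: $A_n$ is the alternating group on $\{1,\dots,n\}$ and $\mathbb C[A_n]$ its group algebra. Partitions of $n$ are identified with Young diagrams; $\lambda'$ is the conjugate (transposed) partition of $\lambda$ (so $\mathrm{UStd}(\lambda)\cup\mathrm{UStd}(\lambda')=\mathrm{UStd}(\lambda)$ when $\lambda=\lambda'$). $\mathrm{Std}(\lambda)$ is the set of standard Young tableaux of shape $\lambda$ (filled with $1,\dots,n$, entries increasing along rows and down columns). The content of the box in row $i$ and column $j$ is $j-i$, and $c(T,m)$ is the content of the box labelled $m$ in $T$. $\mathrm{UStd}(\lambda)=\{T\in\mathrm{Std}(\lambda): c(T,2)=1\}$ is the set of upper standard Young tableaux of shape $\lambda$.
   Formalization: ''Each eigenvalue has multiplicity d_λ'' is read with coincidences counted: the multiplicity of a provided value is the sum of d_μ over all upper tableaux of size n providing it (for n = 4, −1 comes from (2,2) and (3,1) and has multiplicity 5); n ≥ 2. *)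

(* Defs.v *)
From HB Require Import structures.
From mathcomp Require Export all_boot all_order all_algebra.
From mathcomp Require Export all_fingroup all_solvable all_character.
From mathcomp Require Export reals complex.
Set Implicit Arguments.
Unset Strict Implicit.
Unset Printing Implicit Defensive.
Import Order.TTheory GRing.Theory Num.Theory.

(* Indices are shifted by one: the label k.+1 of {1, ..., n} is the element   *)
(* k of 'I_n, and rows and columns of diagrams are numbered from 0.           *)

Section Partitions.
Variable n : nat.

(* A partition of n, padded with zeros to exactly n parts. *)
Definition is_partn (l : {ffun 'I_n -> 'I_n.+1}) : bool :=
  [forall i : 'I_n, forall j : 'I_n, (i <= j) ==> (l j <= l i)]
  && (\sum_(i < n) l i == n).

Record partn : Type := Partn {
  parts :> {ffun 'I_n -> 'I_n.+1};
  _ : is_partn parts }.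

HB.instance Definition _ := [isSub for parts].
HB.instance Definition _ := [Equality of partn by <:].
HB.instance Definition _ := [Choice of partn by <:].
HB.instance Definition _ := [Countable of partn by <:].
HB.instance Definition _ := [Finite of partn by <:].

Definition diagram (l : partn) : {set 'I_n * 'I_n} :=
  [set b : 'I_n * 'I_n | b.2 < l b.1].

Definition conj_parts (l : partn) : {ffun 'I_n -> 'I_n.+1} :=
  [ffun j : 'I_n => inord #|[set i : 'I_n | j < l i]|].

Lemma conj_partsE (l : partn) (j : 'I_n) :
  conj_parts l j = #|[set i : 'I_n | j < l i]| :> nat.
Proof.
rewrite ffunE inordK // ltnS.
by rewrite -[X in _ <= X]card_ord; exact: max_card.
Qed.

Lemma card_ltn_ord (k : nat) : k <= n -> #|[set i : 'I_n | i < k]| = k.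
Proof.
move=> le_kn; rewrite -sum1_card -[RHS]card_ord -sum1_card.
rewrite (big_ord_widen n (fun=> 1) le_kn) /=.
by apply: eq_bigl => i; rewrite inE.
Qed.

Lemma conj_partsP (l : partn) : is_partn (conj_parts l).
Proof.
have /andP[_ /eqP suml] : is_partn l by case: l.
apply/andP; split.
  apply/forallP=> i; apply/forallP=> j; apply/implyP=> le_ij.
  rewrite !conj_partsE; apply/subset_leq_card/subsetP=> k.
  by rewrite !inE; apply: leq_ltn_trans.
apply/eqP; rewrite -[RHS]suml.
transitivity (\sum_(i < n) \sum_(j < n | i < l j) 1).
  by apply: eq_bigr => i _; rewrite conj_partsE -sum1dep_card.
rewrite (exchange_big_dep xpredT) //=; apply: eq_bigr => i _.
have le_n : l i <= n by rewrite -ltnS.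
by rewrite sum1dep_card card_ltn_ord.
Qed.

Definition conj_partn (l : partn) : partn := Partn (conj_partsP l).

Lemma diagram_conj (l : partn) (i j : 'I_n) :
  ((i, j) \in diagram (conj_partn l)) = ((j, i) \in diagram l).
Proof.
have /andP[/forallP decl _] : is_partn l by case: l.
have dec (k k' : 'I_n) : k <= k' -> l k' <= l k.
  by move=> le_kk'; have /forallP/(_ k')/implyP := decl k; apply.
rewrite !inE /= conj_partsE; apply/idP/idP => [lt_j | lt_i].
  case: (ltnP i (l j)) => // le_i; move: lt_j; rewrite ltnNge.
  suff -> : #|[set k : 'I_n | i < l k]| <= j by [].
  rewrite -[X in _ <= X](card_ltn_ord (ltnW (ltn_ord j))).
  apply/subset_leq_card/subsetP => k; rewrite !inE => lt_ik.
  rewrite ltnNge; apply/negP => /dec le_k.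
  by move: (leq_trans lt_ik (leq_trans le_k le_i)); rewrite ltnn.
rewrite -[X in X <= _](card_ltn_ord (ltn_ord j)).
apply/subset_leq_card/subsetP => k; rewrite !inE ltnS => /dec.
exact: leq_trans.
Qed.

(* A filling of a diagram by the n labels is encoded by its inverse, which    *)
(* sends each label to the (row, column) of its box.                          *)
Definition filling := {ffun 'I_n -> 'I_n * 'I_n}.

Definition is_standard (l : partn) (T : filling) : bool :=
  [&& injectiveb T, [set T k | k : 'I_n] == diagram l,
      [forall k : 'I_n, forall k' : 'I_n,
        ((T k).1 == (T k').1) && ((T k).2 < (T k').2) ==> (k < k')]
    & [forall k : 'I_n, forall k' : 'I_n,
        ((T k).2 == (T k').2) && ((T k).1 < (T k').1) ==> (k < k')]].

Definition Std (l : partn) : {set filling} := [set T | is_standard l T].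

Definition nstd (l : partn) : nat := #|Std l|.

Definition content (T : filling) (k : 'I_n) : int :=
  (((T k).2 : nat)%:Z - ((T k).1 : nat)%:Z)%R.

Definition transpose (T : filling) : filling := [ffun k => ((T k).2, (T k).1)].

Lemma transposeK : involutive transpose.
Proof. by move=> T; apply/ffunP => k; rewrite !ffunE /=; case: (T k). Qed.

Lemma Std_transpose (l : partn) (T : filling) :
  T \in Std l -> transpose T \in Std (conj_partn l).
Proof.
rewrite !inE => /and4P[/injectiveP injT /eqP imT rows cols].
apply/and4P; split.
- apply/injectiveP => k k'; rewrite !ffunE => -[e2 e1]; apply: injT.
  by rewrite [T k]surjective_pairing [T k']surjective_pairing e1 e2.
- apply/eqP/setP => -[i j]; rewrite diagram_conj -imT.
  apply/imsetP/imsetP => -[k _]; rewrite ?ffunE => e; exists k => //.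
    by case: e => -> ->; case: (T k).
  by rewrite ffunE -e.
- apply/forallP => k; apply/forallP => k'; rewrite !ffunE.
  by have /forallP/(_ k') := forallP cols k.
- apply/forallP => k; apply/forallP => k'; rewrite !ffunE.
  by have /forallP/(_ k') := forallP rows k.
Qed.

Lemma conj_partnK : involutive conj_partn.
Proof.
move=> l; apply/val_inj/ffunP => i; apply/val_inj.
have rowE (m : partn) : m i = #|[set j : 'I_n | (i, j) \in diagram m]| :> nat.
  rewrite -[LHS](@card_ltn_ord (m i)); last by rewrite -ltnS.
  by apply: eq_card => j; rewrite !inE.
rewrite /= -/(parts _) (rowE (conj_partn (conj_partn l))) (rowE l).
by apply: eq_card => j; rewrite inE [RHS]inE !diagram_conj.
Qed.

Lemma nstd_conj (l : partn) : nstd (conj_partn l) = nstd l.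
Proof.
have le m : nstd m <= nstd (conj_partn m).
  rewrite /nstd -(card_imset _ (can_inj transposeK)).
  apply/subset_leq_card/subsetP => _ /imsetP[T + ->].
  exact: Std_transpose.
by apply/eqP; rewrite eqn_leq -{2}[l]conj_partnK !le.
Qed.

End Partitions.

Local Open Scope ring_scope.

Section Upper.
Variable m : nat.
Local Notation n := m.+2.

Definition UStd (l : partn n) : {set filling n} :=
  [set T in Std l | content T (inord 1) == 1].

Definition lastl : 'I_n := ord_max.    (* the label n *)
Definition penl : 'I_n := inord m.     (* the label n - 1 *)

(* The eigenvalues provided by T; the two values of the third case are listed *)
(* separately, even when they coincide (both being 0).                        *)
Definition evals (T : filling n) : seq int :=
  let a := content T lastl in
  let b := content T penl in
  if a == b + 1 then [:: 2 * a - 1]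
  else if a == b - 1 then [:: - (2 * a + 1)]
  else if b < a then [:: a + b; - (a + b)]
  else [::].

(* For distinct i, j, k this is the 3-cycle i -> j -> k -> i: in s * t the    *)
(* permutation s is applied first.                                            *)
Definition cycle3 (i j k : 'I_n) : {perm 'I_n} := (tperm i j * tperm i k)%g.

Lemma cycle3E (i j k : 'I_n) : i != j -> i != k -> j != k ->
  [/\ cycle3 i j k i = j, cycle3 i j k j = k, cycle3 i j k k = i
    & cycle3 i j k \in ('Alt_('I_n))%g].
Proof.
move=> ij ik jk; split; rewrite ?permM.
- by rewrite tpermL tpermD // eq_sym.
- by rewrite tpermR tpermL.
- by rewrite (tpermD ik jk) tpermR.
- by rewrite Alt_even odd_permM !odd_tperm ij ik.
Qed.

(* The matrix of v |-> v * P on C[A_n]. The regular representation acts on    *)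
(* row vectors, the basis vector of g being sent by h to that of g * h; hence *)
(* eigenspace and eigenvalue, which also use row vectors, are those of right  *)
(* multiplication.                                                            *)
Definition Pmx (C : fieldType) : 'M[C]_#|('Alt_('I_n))%g| :=
  let aG := regular_repr C ('Alt_('I_n))%g in
  aG 1%g + \sum_(i < n | (i < m)%N)
             (aG (cycle3 i penl lastl) + aG (cycle3 i lastl penl)).

End Upper.

(* Main.v *)
From HB Require Import structures.
From mathcomp Require Import zify ring.
Require Import Defs.
Set Implicit Arguments.
Unset Strict Implicit.
Unset Printing Implicit Defensive.
Import Order.TTheory GRing.Theory Num.Theory.

(* Put s = (n-1, n) and let J_1, ..., J_n be the Jucys-Murphy elements; then   *)
(* P = s (J_{n-1} + J_n).  For standard tableaux S, T of the same shape there  *)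
(* is a nonzero v_{S,T} in C[S_n] which is a joint eigenvector of the left     *)
(* J_k with the contents of S and of the right J_k with the contents of T:     *)
(* for S sorted by rows and T sorted by columns, the polytabloid               *)
(* (row symmetrizer) * (column antisymmetrizer) is one by the Garnir relations, *)
(* and the general case follows with Young's intertwiners s_i - 1/(difference  *)
(* of contents).  The vectors v_{S,T} + eps v_{S,T} s, with eps the sign of    *)
(* a_n - a_{n-1} in T, are nonzero eigenvectors of P for the eigenvalue        *)
(* eps (a_n + a_{n-1}); they have distinct joint eigenvalues under the left    *)
(* J_k, the right J_k for k <= n-2 and s, so they are independent, and they    *)
(* form a basis because the squares of the d_lambda add up to n!.  As a right  *)
(* module C[S_n] is the sum of two copies of C[A_n], which halves the          *)
(* multiplicities; transposing a tableau preserves the eigenvalue and          *)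
(* exchanges upper and lower tableaux.                                         *)

(** * The sum of the squares of the numbers of standard tableaux *)

(** If v is a joint eigenvector of the right Jucys-Murphy elements with contents a, then right
    multiplication by P exchanges v and v s up to the factor a_{n-1} + a_n ([Pfun_JM],
    [Pfun_JM_swap]), so v + eps v s is an eigenvector for eps = 1 or -1. Every pair of standard
    tableaux S, T of one shape yields such a v ([joint_exists]), and taking for eps the sign of a_n
    - a_{n-1} keeps the sum nonzero ([eigenvector_exists]). These vectors are independent
    ([joint_eigenvectors_free]) and there are at least n! of them ([fact_le_std_pairs]), so they
    diagonalize P on C[S_n]. Hence twice the multiplicity of x on C[A_n] is the number of pairs in
    which T yields x ([spectrum]).

    A tableau T of shape mu occurs in d_mu pairs. Transposition cancels the factor 2 and leaves the
    upper tableaux ([sum_nstd_num_Std]); exchanging the labels n-1 and n then matches their values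
    with those listed by [evals] ([num_UStd_evals]). For n = 3 this exchange moves the label 2, and
    the value 0 has to be set aside; no upper tableau provides it there ([evals_neq0]). Several
    tableaux, even of different shapes, may provide the same number, so the multiplicity is the sum
    of the corresponding d_mu. *)

Section LatticeWords.
Implicit Types (w m : seq nat) (i j n N : nat).

Local Notation del := (@rem nat).
Local Notation consn := (@cons nat).

(** A word stands for the diagram whose row [i] has as many boxes as the word has letters [i]; only
    the letter counts matter here. *)
Definition shapelike m := forall i, count_mem i.+1 m <= count_mem i m.
Definition addable m i := (i == 0) || (count_mem i m < count_mem i.-1 m).
Definition removable m i := count_mem i.+1 m < count_mem i m.

(* Words are read from right to left. *)
Fixpoint lattice n : seq (seq nat) :=
  if n is n'.+1 then
    [seq i :: w | w <- lattice n', i <- [seq i <- iota 0 n | addable w i]]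
  else [:: [::]].

(** For a diagram [m] of size [n] this is the number of standard tableaux of that shape. *)
Definition nwords n m := count (perm_eq m) (lattice n).

Lemma latticeE n : lattice n.+1 =
  [seq i :: w | w <- lattice n, i <- [seq i <- iota 0 n.+1 | addable w i]].
Proof. by []. Qed.

Lemma mem_latticeS n x : (x \in lattice n.+1) =
  if x is i :: w then [&& w \in lattice n, i < n.+1 & addable w i] else false.
Proof.
apply/allpairsPdep/idP => [[w [i [wY]]]|].
  by rewrite mem_filter mem_iota => /and3P[a _ lin] ->; rewrite wY a lin.
case: x => // i w /and3P[wY lin a]; exists w, i; split => //.
by rewrite mem_filter mem_iota a lin.
Qed.

Lemma lattice_uniq n : uniq (lattice n).
Proof.
elim: n => [//|n IH]; apply: allpairs_uniq_dep => //.
- by move=> w _; rewrite filter_uniq ?iota_uniq.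
- by move=> [w i] [w' i'] _ _ /= [-> ->].
Qed.

Lemma shapelike_cons m i : shapelike m -> addable m i -> shapelike (i :: m).
Proof.
move=> sm a j /=; have := sm j; case: (eqVneq i j.+1) => [e|_].
  by move: a; rewrite e /addable /= (gtn_eqF (ltnSn j)).
by rewrite add0n => h; apply: leq_trans h (leq_addl _ _).
Qed.

Lemma latticeP n w : w \in lattice n -> size w = n /\ shapelike w.
Proof.
elim: n w => [|n IH] w; first by rewrite inE => /eqP ->.
rewrite mem_latticeS; case: w => // i w /and3P[/IH[<- sw] _ a].
by split=> //; apply: shapelike_cons.
Qed.

Lemma shapelike_ltn m i : shapelike m -> i \in m -> i < size m.
Proof.
move=> sm im; have mem j : j <= i -> j \in m.
  move=> /subnK; move: (i - j) => d e; move: im; rewrite -{}e -!has_pred1 !has_count.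
  elim: d => // d IH h; apply: IH; exact: leq_trans h (sm _).
rewrite -(size_iota 0 i.+1); apply: uniq_leq_size (iota_uniq _ _) _ => j.
by rewrite mem_iota => /mem.
Qed.

Lemma shapelike_perm m w : perm_eq m w -> shapelike m -> shapelike w.
Proof. by move=> /seq.permP e sm i; rewrite -!e. Qed.

Lemma addable_perm m w i : perm_eq m w -> addable m i = addable w i.
Proof. by move=> /seq.permP e; rewrite /addable !e. Qed.

Lemma removable_mem m i : removable m i -> i \in m.
Proof. by rewrite -has_pred1 has_count; apply: leq_ltn_trans. Qed.

Lemma count_rem_mem m i j : i \in m ->
  count_mem j (del i m) = count_mem j m - (i == j).
Proof. by move=> im; rewrite (seq.permP (perm_to_rem im)) /= addKn. Qed.

Lemma perm_consr m w i :
  perm_eq m (i :: w) = (i \in m) && perm_eq (del i m) w.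
Proof.
case: (boolP (i \in m)) => [im|nim] /=.
  by rewrite (permPl (perm_to_rem im)) perm_cons.
by apply/negP => /perm_mem/(_ i); rewrite mem_head (negPf nim).
Qed.

(** Branching rule: the head of a lattice word is the row of the last box added. The bound [N] is
    kept apart from [n] so that sums for different [n] range over the same rows. *)
Lemma nwordsS n N m : shapelike m -> size m = n.+1 -> n < N ->
  nwords n.+1 m = \sum_(i < N | removable m i) nwords n (del i m).
Proof.
move=> sm szm ltnN.
have -> : nwords n.+1 m = \sum_(w <- lattice n) \sum_(0 <= i < n.+1 | addable w i)
     perm_eq m (i :: w).
  rewrite /nwords -sum1_count big_mkcond latticeE big_allpairs_dep.
  apply: eq_bigr => w _; rewrite big_filter /index_iota subn0.
  by apply: eq_bigr => i _; case: perm_eq.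
transitivity (\sum_(w <- lattice n) \sum_(0 <= i < n.+1 | removable m i) perm_eq (del i m) w).
  apply: eq_big_seq => w /latticeP[szw sw].
  rewrite big_mkcond [RHS]big_mkcond; apply: eq_bigr => i _.
  rewrite perm_consr; case: (boolP (i \in m)) => [im|nim] /=; last first.
    rewrite if_same; case: ifP => // /removable_mem; by rewrite (negPf nim).
  case pe: perm_eq; last by rewrite !if_same.
  have -> : addable w i.
    rewrite -(addable_perm _ pe) /addable !(count_rem_mem _ im) eqxx.
    case: i im {pe} => // i im /=; rewrite (gtn_eqF (ltnSn i)) subn0.
    move: im; rewrite -has_pred1 has_count => h.
    by have := sm i; case: (count_mem i.+1 m) h => // c _; rewrite subn1.
  have /(_ i) := shapelike_perm (etrans (perm_sym _ _) pe) sw.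
  rewrite !(count_rem_mem _ im) eqxx (ltn_eqF (ltnSn i)) subn0 /removable.
  move: im; rewrite -has_pred1 has_count; case: (count_mem i m) => // c _.
  by rewrite subn1 ltnS => ->.
rewrite (exchange_big_dep (removable m)) //= big_mkord.
rewrite (big_ord_widen_cond N (removable m)
  (fun i => \sum_(w <- lattice n | removable m i) (perm_eq (del i m) w : nat))) //.
apply: eq_big => [i|i].
  rewrite andb_idr // => /removable_mem/(shapelike_ltn sm); by rewrite szm.
rewrite /nwords -sum1_count [RHS]big_mkcond; case/andP=> -> _.
by apply: eq_bigr => w _; case: perm_eq.
Qed.

Lemma nwords_perm n m w : perm_eq m w -> nwords n m = nwords n w.
Proof. by move=> e; apply: eq_count => x; rewrite (permPl e). Qed.

(** Row [i.+1] is addable exactly when row [i] is removable, and row 0 is always addable. *)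
Lemma card_addable N m : shapelike m -> size m < N ->
  \sum_(i < N | addable m i) 1 = (\sum_(i < N | removable m i) 1).+1.
Proof.
case: N => // N sm; rewrite ltnS => szm.
rewrite big_mkcond big_ord_recl /= add1n; congr _.+1.
rewrite [RHS]big_mkcond big_ord_recr /= [X in _ = _ + X]ifF ?addn0 //.
apply/negP => /removable_mem/(shapelike_ltn sm); by rewrite ltnNge szm.
Qed.

(* The commutation relation [D, U] = 1 of Young's lattice, for i != j. *)
Lemma addable_removable m i j : shapelike m -> i != j ->
  addable m i && removable (i :: m) j = removable m j && addable (del j m) i.
Proof.
move=> sm nij; case: (boolP (removable m j)) => [rj|nrj] /=; last first.
  apply/negP => /andP[_]; rewrite /removable /= (negPf nij) add0n => h.
  case/negP: nrj; exact: leq_ltn_trans (leq_addl _ _) h.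
have jm := removable_mem rj.
rewrite /addable /removable /= !(count_rem_mem _ jm) (eq_sym j i) (negPf nij) add0n subn0.
have := sm j; move: rj; rewrite /removable.
case: i nij => [|i] /=; first by move=> _ rj _; rewrite add0n.
rewrite eqSS (eq_sym i j) => nij; case: (eqVneq j i) nij => [<-|_] nij rj _ /=.
  by rewrite ltn_subRL andb_idl // => /ssrnat.ltnW.
by rewrite add0n rj andbT subn0.
Qed.

(** Expand each term by the branching rule. Removing the box just added gives [m] back, once per
    addable row; every other removal commutes with the addition and falls under the induction
    hypothesis. The one surplus addable row accounts for the increase of the factor. *)
Lemma nwords_up n N m : shapelike m -> size m = n -> n < N ->
  \sum_(i < N | addable m i) nwords n.+1 (consn i m) = n.+1 * nwords n m.
Proof.
elim: n m => [|n IH] m sm szm ltnN.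
  case: m szm sm => // _ _; case: N ltnN => // N _.
  by rewrite big_mkcond big_ord_recl big1.
transitivity (\sum_(i < N | addable m i) (nwords n.+1 m +
   \sum_(j < N | removable (consn i m) j && (j != i)) nwords n.+1 (consn i (del j m)))).
  apply: eq_bigr => i a.
  rewrite (nwordsS (shapelike_cons sm a) (congr1 succn szm) ltnN).
  have ri : removable (consn i m) i.
    by rewrite /removable /= eqxx (ltn_eqF (ltnSn i)) add0n add1n ltnS.
  rewrite (bigD1 i) //= eqxx; congr (_ + _); apply: eq_bigr => j /andP[_ nji].
  by rewrite eq_sym (_ : (nat_of_ord j == i) = false) //; apply/negbTE.
rewrite big_split /=.
have -> : \sum_(i < N | addable m i) nwords n.+1 m =
    (\sum_(i < N | removable m i) 1).+1 * nwords n.+1 m.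
  rewrite -card_addable ?szm ?(ssrnat.ltnW ltnN) // big_distrl /=.
  by apply: eq_bigr => i _; rewrite mul1n.
rewrite (exchange_big_dep (fun j : 'I_N => removable m j)) /=; last first.
  move=> i j a /andP[r nji]; have := addable_removable sm (_ : i != j :> nat).
  by rewrite a r /= eq_sym => /(_ nji)/esym/andP[].
rewrite mulSn -addnA mulSn; congr (_ + _); rewrite big_distrl -big_split /=.
rewrite [in RHS](nwordsS sm szm (ssrnat.ltnW ltnN)) big_distrr /=; apply: eq_bigr => j r.
have jm := removable_mem r.
have sd : shapelike (del j m).
  move=> i; rewrite !(count_rem_mem _ jm); case: (eqVneq (j : nat) i) => [<-|_].
    rewrite (ltn_eqF (ltnSn j)) subn0; move: r; rewrite /removable.
    by case: (count_mem (j : nat) m) => // c; rewrite subn1.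
  by rewrite subn0; apply: leq_trans (sm i); apply: leq_subr.
have szd : size (del j m) = n by rewrite size_rem ?szm.
rewrite mul1n -[RHS](IH _ sd szd (ltn_trans (ltnSn n) ltnN)).
have aj : addable (del j m) j.
  rewrite /addable !(count_rem_mem _ jm) eqxx; case: (j : nat) jm => //= k.
  rewrite (gtn_eqF (ltnSn k)) subn0 -has_pred1 has_count => h.
  by have := sm k; case: (count_mem k.+1 m) h => // c _; rewrite subn1.
(* The induction hypothesis for [del j m] includes the row [i = j], whose term is [nwords] of [m]
   itself; the copies of that number set aside above supply it. *)
rewrite [RHS](bigD1 j) //=; congr (_ + _).
  by apply: nwords_perm; rewrite perm_to_rem.
apply: eq_bigl => i; rewrite andbA andbC eq_sym [RHS]andbC.
case: eqVneq => //= nij; rewrite andbC.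
by rewrite andbC (addable_removable sm) // r.
Qed.

(** This is the sum of the squares of the d_lambda, because each shape is listed once for every
    lattice word having it. *)
Lemma sum_nwords n : \sum_(w <- lattice n) nwords n w = n`!.
Proof.
elim: n => [|n IH]; first by rewrite big_seq1.
rewrite factS -IH big_distrr latticeE big_allpairs_dep.
apply: eq_big_seq => w /latticeP[szw sw].
apply: etrans (nwords_up sw szw (ltnSn n)).
by rewrite big_filter -[iota _ _]/(index_iota 0 n.+1) big_mkord.
Qed.

End LatticeWords.

(** Suffixes of a lattice word are lattice words, so at every moment the boxes added so far form a
    diagram. *)
Lemma lattice_take n w k : w \in lattice n -> shapelike (take k (rev w)).
Proof.
elim: n w k => [|n IH] w k wY; first by move: wY; rewrite inE => /eqP ->.
move: (wY); rewrite mem_latticeS; case: w wY => // i w wY /and3P[w'Y _ _].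
rewrite rev_cons -cats1 take_cat; case: ltnP => _; first exact: IH.
case: (k - _) => [|d] /=; first by rewrite cats0 -[rev w]take_size; apply: IH.
rewrite cats1 -rev_cons.
have [_ s] := latticeP wY; apply: shapelike_perm s.
by rewrite perm_sym (perm_rev (i :: w)).
Qed.

Lemma card_diagram n (la : partn n) : #|diagram la| = n.
Proof.
have /andP[_ /eqP suml] : is_partn la by case: la.
rewrite -[RHS]suml -sum1dep_card.
rewrite -(pair_big_dep xpredT (fun i j : 'I_n => j < la i) (fun _ _ => 1)) /=.
apply: eq_bigr => i _; have le : la i <= n by rewrite -ltnS.
by rewrite sum1dep_card card_ltn_ord.
Qed.

(** * From lattice words to standard tableaux *)

Section WordTableau.
Variables (p : nat) (w : seq nat).
Local Notation n := p.+1.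
Hypothesis wY : w \in lattice n.
Local Notation v := (rev w).

Definition word_filling : filling n :=
  [ffun k : 'I_n => (inord (nth 0 v k), inord (count_mem (nth 0 v k) (take k v)))].

Definition word_parts : {ffun 'I_n -> 'I_n.+1} :=
  [ffun i : 'I_n => inord (count_mem (i : nat) w)].

Let szw : size w = n. Proof. by have [] := latticeP wY. Qed.
Let szv : size v = n. Proof. by rewrite size_rev. Qed.
Let sw : shapelike w. Proof. by have [] := latticeP wY. Qed.

Lemma word_partsE i : word_parts i = count_mem (i : nat) w :> nat.
Proof. by rewrite ffunE inordK // ltnS; apply: leq_trans (count_size _ _) _; rewrite szw. Qed.

Let count_v i : count_mem i v = count_mem i w.
Proof. exact: count_rev. Qed.

Lemma shapelike_le m i j : shapelike m -> i <= j -> count_mem j m <= count_mem i m.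
Proof.
move=> sm /subnK <-; elim: (j - i) => // d IH; exact: leq_trans (sm _) IH.
Qed.

Let row_ltn (k : 'I_n) : nth 0 v k < n.
Proof.
have : nth 0 v k \in w by rewrite -mem_rev mem_nth ?szv.
by move=> /(shapelike_ltn sw); rewrite szw.
Qed.

Let takeS (k : 'I_n) : take k.+1 v = rcons (take k v) (nth 0 v k).
Proof. by rewrite (take_nth 0) ?szv. Qed.

Let count_take_le i a b : a <= b -> count_mem i (take a v) <= count_mem i (take b v).
Proof.
by move=> ab; rewrite -[take b v](cat_take_drop a) count_cat take_takel // leq_addr.
Qed.

Let count_takeS (k : 'I_n) i :
  count_mem i (take k.+1 v) = (nth 0 v k == i) + count_mem i (take k v).
Proof. by rewrite takeS -cats1 count_cat /= addn0 addnC. Qed.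

Let col_ltn (k : 'I_n) : count_mem (nth 0 v k) (take k v) < count_mem (nth 0 v k) w.
Proof.
have := count_takeS k (nth 0 v k); rewrite eqxx add1n => <-.
by rewrite -count_v -[X in _ <= count _ X](take_size v) szv; apply: count_take_le.
Qed.

Lemma word_filling1 k : (word_filling k).1 = nth 0 v k :> nat.
Proof. by rewrite ffunE /= inordK. Qed.

Lemma word_filling2 k : (word_filling k).2 = count_mem (nth 0 v k) (take k v) :> nat.
Proof.
rewrite ffunE /= inordK //; apply: leq_trans (col_ltn _) _.
by apply: leq_trans (count_size _ _) _; rewrite szw.
Qed.

Let row_incr (k k' : 'I_n) : nth 0 v k = nth 0 v k' -> k < k' ->
  count_mem (nth 0 v k) (take k v) < count_mem (nth 0 v k') (take k' v).
Proof.
by move=> e kk'; have := count_take_le (nth 0 v k) kk'; rewrite count_takeS eqxx -e.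
Qed.

Lemma word_parts_partn : is_partn word_parts.
Proof.
apply/andP; split.
  apply/forallP => i; apply/forallP => j; apply/implyP => ij.
  by rewrite !word_partsE shapelike_le.
apply/eqP; rewrite -[RHS]szw; under eq_bigr do rewrite word_partsE -sum1_count.
rewrite (exchange_big_dep xpredT) //= -sum1_size; apply: eq_big_seq => a aw.
have lt : a < n by have := shapelike_ltn sw aw; rewrite szw.
by rewrite (big_pred1 (Ordinal lt)) // => i; rewrite -val_eqE /= eq_sym.
Qed.

Definition word_partn : partn n := Partn word_parts_partn.

Lemma word_filling_Std : word_filling \in Std word_partn.
Proof.
have inj : injective word_filling.
  move=> k k' e; have e1 : nth 0 v k = nth 0 v k' by rewrite -!word_filling1 e.
  have e2 : count_mem (nth 0 v k) (take k v) = count_mem (nth 0 v k') (take k' v).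
    by rewrite -!word_filling2 e.
  apply/val_inj; case: (ltngtP k k') => // kk'.
  - by have := row_incr e1 kk'; rewrite e2 ltnn.
  - by have := row_incr (esym e1) kk'; rewrite e2 ltnn.
rewrite inE; apply/and4P; split.
- exact/injectiveP.
- rewrite eqEcard card_imset // card_ord card_diagram leqnn andbT.
  apply/subsetP => _ /imsetP[k _ ->].
  by rewrite inE /= word_partsE word_filling1 word_filling2.
- apply/forallP => k; apply/forallP => k'; apply/implyP => /andP[/eqP e].
  have e1 : nth 0 v k = nth 0 v k' by rewrite -!word_filling1 e.
  rewrite !word_filling2; case: (ltngtP k k') => // [kk'|/val_inj ->].
    by rewrite ltnNge ssrnat.ltnW ?(row_incr (esym e1)).
  by rewrite ltnn.
- apply/forallP => k; apply/forallP => k'; apply/implyP => /andP[/eqP e].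
  have e2 : count_mem (nth 0 v k) (take k v) = count_mem (nth 0 v k') (take k' v).
    by rewrite -!word_filling2 e.
  rewrite !word_filling1 => lt; case: (ltngtP k k') => // [kk'|/val_inj kk']; last first.
    by move: lt; rewrite kk' ltnn.
  (* If the lower box were filled first, then just afterwards the lower row would be longer than the
     upper one. *)
  have := shapelike_le (lattice_take k'.+1 wY) (ssrnat.ltnW lt).
  rewrite !count_takeS eqxx (gtn_eqF lt) -e2 add1n add0n => h.
  have := leq_trans h (count_take_le (nth 0 v k) (ssrnat.ltnW kk')).
  by rewrite ltnn.
Qed.
End WordTableau.

Lemma word_filling_inj p (w w' : seq nat) :
  w \in lattice p.+1 -> w' \in lattice p.+1 ->
  word_filling p w = word_filling p w' -> w = w'.
Proof.
move=> wY w'Y e; have [szw _] := latticeP wY; have [szw' _] := latticeP w'Y.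
apply: (can_inj revK).
apply: (@eq_from_nth _ 0); rewrite !size_rev ?szw // => i lt.
by rewrite -(word_filling1 wY (Ordinal lt)) e word_filling1.
Qed.

Definition std_pair n := [set p : filling n * filling n |
  [exists la, (p.1 \in Std la) && (p.2 \in Std la)]].

(** Pairs of lattice words with equal letter counts number n! and inject into pairs of tableaux of
    one shape. The opposite inequality will come from the independence of the eigenvectors. *)
Lemma fact_le_std_pairs p : p.+1`! <= #|std_pair p.+1|.
Proof.
pose ps := [seq (w, w') | w <- lattice p.+1,
  w' <- [seq w' <- lattice p.+1 | perm_eq w w']].
have szps : size ps = p.+1`!.
  rewrite -sum_nwords -sum1_size big_allpairs_dep; apply: eq_bigr => w _.
  by rewrite sum1_size size_filter.
have ups : uniq ps.
  apply: allpairs_uniq_dep; rewrite ?lattice_uniq //.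
    by move=> w _; rewrite filter_uniq ?lattice_uniq.
  by move=> [w1 w2] [w1' w2'] _ _ /= [-> ->].
rewrite -szps -(size_map (fun x => (word_filling p x.1, word_filling p x.2))).
rewrite cardE; apply: uniq_leq_size.
  rewrite map_inj_in_uniq // => -[w1 w2] [w1' w2'].
  move=> /allpairsPdep[? [? [a1 + [-> ->]]]]; rewrite mem_filter => /andP[_ a2].
  move=> /allpairsPdep[? [? [b1 + [-> ->]]]]; rewrite mem_filter => /andP[_ b2].
  move=> /= [e1 e2]; congr (_, _);
    exact: (word_filling_inj _ _ e1) || exact: (word_filling_inj _ _ e2).
move=> _ /mapP[[w1 w2] + ->] /=.
move=> /allpairsPdep[w [w' [wY + [-> ->]]]]; rewrite mem_filter => /andP[pe w'Y].
rewrite mem_enum inE /=; apply/existsP; exists (word_partn wY).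
rewrite word_filling_Std /=; suff <- : word_partn w'Y = word_partn wY by exact: word_filling_Std.
by apply/val_inj/ffunP => i; rewrite !ffunE (seq.permP pe).
Qed.

(** * Standard tableaux and their contents *)

Section StandardTableaux.
Variable n : nat.
Implicit Types (la : partn n) (T : filling n) (k i : 'I_n) (b : 'I_n * 'I_n).

Definition box_le b b' := (b.1 <= b'.1) && (b.2 <= b'.2).

Lemma StdP la T : reflect
  [/\ injective T, forall b, b \in diagram la <-> exists k, T k = b,
      forall k k', (T k).1 = (T k').1 -> (T k).2 < (T k').2 -> k < k'
    & forall k k', (T k).2 = (T k').2 -> (T k).1 < (T k').1 -> k < k']
  (T \in Std la).
Proof.
rewrite inE; apply: (iffP and4P) => [[/injectiveP inj /eqP im rows cols]|[inj im rows cols]].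
  split=> // [b|k k' e lt|k k' e lt].
  - rewrite -im; split=> [/imsetP[k _ ->]|[k <-]]; first by exists k.
    exact: imset_f.
  - by have /forallP/(_ k') := forallP rows k; rewrite e eqxx lt.
  - by have /forallP/(_ k') := forallP cols k; rewrite e eqxx lt.
split.
- exact/injectiveP.
- apply/eqP/setP => b; apply/imsetP/idP => [[k _ ->]|/im[k <-]]; last by exists k.
  by apply/im; exists k.
- apply/forallP => k; apply/forallP => k'; apply/implyP => /andP[/eqP]; exact: rows.
- apply/forallP => k; apply/forallP => k'; apply/implyP => /andP[/eqP]; exact: cols.
Qed.

Lemma Std_inj la T : T \in Std la -> injective T.
Proof. by case/StdP. Qed.

Lemma Std_diagram la T k : T \in Std la -> T k \in diagram la.
Proof. by case/StdP => _ im _ _; apply/im; exists k. Qed.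

(** Go up the column of [T k] to the row of [b], then left along that row: the labels decrease on
    both legs. *)
Lemma Std_below la T k b : T \in Std la -> box_le b (T k) ->
  exists2 k' : 'I_n, k' <= k & T k' = b.
Proof.
move=> sT; have [_ im rows cols] := StdP _ _ sT.
case: b => i j; rewrite /box_le /= => /andP[le1 le2].
have dk : (T k).2 < la i.
  have /andP[/forallP/(_ i)/forallP/(_ (T k).1)/implyP/(_ le1) dec _] : is_partn la by case: la {sT im}.
  by apply: leq_trans dec; have := Std_diagram k sT; rewrite inE.
have [k1 e1] : exists k1, T k1 = (i, (T k).2) by apply/im; rewrite inE.
have [k2 e2] : exists k2, T k2 = (i, j).
  by apply/im; rewrite inE /=; apply: leq_ltn_trans dk.
have le21 : k2 <= k1.
  move: le2; rewrite leq_eqVlt => /orP[/eqP/val_inj ej|lt].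
    by rewrite (Std_inj sT (_ : T k2 = T k1)) // e1 e2 ej.
  by apply/ssrnat.ltnW/rows; rewrite e1 e2.
exists k2 => //; apply: leq_trans le21 _.
move: le1; rewrite leq_eqVlt => /orP[/eqP/val_inj ei|lt].
  by rewrite (Std_inj sT (_ : T k1 = T k)) // e1 ei -surjective_pairing.
by apply/ssrnat.ltnW/cols; rewrite e1.
Qed.

Lemma content_box_le T T' k k' : (`|content T k - content T' k'| <= 1)%R ->
  box_le (T k) (T' k') \/ box_le (T' k') (T k).
Proof. rewrite /content /box_le; lia. Qed.

(** Boxes of equal content lie on one diagonal and are comparable. If [T k] is weakly below [T' k]
    in the box order, it is [T' k'] for some [k' <= k], and induction with injectivity of [T]
    excludes [k' < k]. *)
Lemma content_prefix la la' T T' d : T \in Std la -> T' \in Std la' ->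
  (forall k, k < d -> content T k = content T' k) ->
  forall k, k < d -> T k = T' k.
Proof.
move=> + + + k; have [m] := ubnP k; elim: m la la' T T' k => // m IH la la' T T' k.
rewrite ltnS => km sT sT' e kd.
wlog le : la la' T T' sT sT' e / box_le (T k) (T' k).
  move=> W; have : box_le (T k) (T' k) \/ box_le (T' k) (T k).
    by apply: content_box_le; rewrite e // subrr normr0.
  case=> [le|le]; first exact: (W _ _ _ _ sT sT' e le).
  by apply/esym/(W _ _ _ _ sT' sT _ le) => k' /e ->.
have [k' le' ek'] := Std_below sT' le.
case: (ltngtP k' k) le' => // [lt|ekk] _; last by rewrite -ek'; congr (T' _); apply: val_inj.
have := IH la la' T T' k' (leq_trans lt km) sT sT' e (ltn_trans lt kd).
by rewrite ek' => /(Std_inj sT) ekk; rewrite ekk ltnn in lt.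
Qed.

Definition swap T i i1 : filling n := [ffun k => T (tperm i i1 k)].

Lemma swapK T i i1 : swap (swap T i i1) i i1 = T.
Proof. by apply/ffunP => k; rewrite !ffunE tpermK. Qed.

Lemma content_swap T i i1 k : content (swap T i i1) k = content T (tperm i i1 k).
Proof. by rewrite /content ffunE. Qed.

(** * Exchanging two consecutive labels *)

Section Consecutive.
Variables (la : partn n) (T : filling n) (i i1 : 'I_n).
Hypotheses (sT : T \in Std la) (ei : i1 = i.+1 :> nat).

Let between b : box_le (T i) b -> box_le b (T i1) -> b = T i \/ b = T i1.
Proof.
move=> le1 le2; have [k' lek ek] := Std_below sT le2; subst b.
have [k lek' ek] := Std_below sT le1; rewrite (Std_inj sT ek) {k ek} in lek'.
move: lek; rewrite ei leq_eqVlt ltnS => /orP[/eqP e|le]; [right|left]; congr (T _).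
  by apply: val_inj; rewrite /= ei.
by apply: val_inj; apply/eqP; rewrite eqn_leq le lek'.
Qed.

(** A third box between the two would need a label between two consecutive ones, so comparable boxes
    must be neighbours. *)
Lemma box_le_adjacent : box_le (T i) (T i1) ->
  (`|content T i - content T i1| = 1)%R.
Proof.
move=> le; have nT : T i <> T i1.
  by move=> /(Std_inj sT) e; move: ei; rewrite -e => /eqP; rewrite ltn_eqF.
have {}nT : (T i).1 <> (T i1).1 :> nat \/ (T i).2 <> (T i1).2 :> nat.
  case: (eqVneq (T i).1 (T i1).1) => [e1|ne]; last by left=> /val_inj/eqP; apply/negP.
  right=> /val_inj e2; apply: nT.
  by rewrite [T i]surjective_pairing [T i1]surjective_pairing e1 e2.
rewrite /content.
case: (ltngtP (T i).1 (T i1).1) => c1; last first.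
- case: (ltngtP (T i).2 (T i1).2) => c2.
  + have lt : (T i).2.+1 < n by apply: leq_ltn_trans c2 _.
    have /= := @between ((T i).1, Ordinal lt).
    rewrite /box_le /= leqnn leqnSn /= c1 leqnn c2 => /(_ isT isT)[e|e].
      have /(congr1 (fun x => nat_of_ord x.2)) /= := e; lia.
    have /(congr1 (fun x => nat_of_ord x.2)) /= := e; lia.
  + move: le; rewrite /box_le; lia.
  + lia.
- move: le; rewrite /box_le; lia.
- have lt : (T i).1.+1 < n by apply: leq_ltn_trans c1 _.
  have /= := @between (Ordinal lt, (T i).2).
  move: le; rewrite /box_le /= leqnn leqnSn c1 /= => /andP[_ le2]; rewrite le2 => /(_ isT isT)[e|e].
    have /(congr1 (fun x => nat_of_ord x.1)) /= := e; lia.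
  have /(congr1 (fun x => nat_of_ord x.1)) /= := e.
  have /(congr1 (fun x => nat_of_ord x.2)) /= := e; lia.
Qed.

Lemma not_box_ge : ~~ box_le (T i1) (T i).
Proof.
apply/negP => le; have [k lek ek] := Std_below sT le.
by move: lek; rewrite (Std_inj sT ek) ei ltnn.
Qed.

Lemma content_consecutive : content T i != content T i1.
Proof.
apply/eqP => e; have [] := content_box_le (T := T) (T' := T) (k := i) (k' := i1) _.
- by rewrite e subrr normr0.
- by move=> /box_le_adjacent; rewrite e subrr normr0.
- by move=> le; have := not_box_ge; rewrite le.
Qed.

Lemma incomparable_content : ~~ box_le (T i) (T i1) ->
  (1 < `|content T i - content T i1|)%R.
Proof.
move=> nle; rewrite ltNge; apply/negP => /content_box_le[le|le].
  by rewrite le in nle.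
by have := not_box_ge; rewrite le.
Qed.

(** The exchange reverses the order of [i] and [i1] only, and the row and column conditions compare
    only comparable boxes. *)
Lemma swap_Std : ~~ box_le (T i) (T i1) -> swap T i i1 \in Std la.
Proof.
move=> nle; have [inj im rows cols] := StdP _ _ sT.
have mono (R : rel ('I_n * 'I_n)) : (forall b b', R b b' -> box_le b b') ->
    (forall k k', R (T k) (T k') -> k < k') ->
  forall k k', R (swap T i i1 k) (swap T i i1 k') -> k < k'.
  move=> sub RT k k'; rewrite !ffunE => r; have lt := RT _ _ r; have le := sub _ _ r.
  move: lt; case: tpermP => [ek|ek|/eqP + /eqP]; case: tpermP => [ek'|ek'|/eqP + /eqP];
    rewrite ?ek ?ek' -?val_eqE /= ?ei; try lia.
  by move: le; rewrite ek ek' tpermL tpermR (negPf nle).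
apply/StdP; split.
- by move=> k k'; rewrite !ffunE => /inj/perm_inj.
- move=> b; rewrite im; split=> -[k <-]; exists (tperm i i1 k); rewrite ffunE ?tpermK //.
- move=> k k' e lt; apply: (mono (fun b b' => (b.1 == b'.1) && (b.2 < b'.2))).
  + by move=> b b' /andP[/eqP e' /ssrnat.ltnW le]; rewrite /box_le e' leqnn.
  + by move=> ? ? /andP[/eqP]; apply: rows.
  + by rewrite e eqxx.
- move=> k k' e lt; apply: (mono (fun b b' => (b.2 == b'.2) && (b.1 < b'.1))).
  + by move=> b b' /andP[/eqP e' /ssrnat.ltnW le]; rewrite /box_le e' leqnn andbT.
  + by move=> ? ? /andP[/eqP]; apply: cols.
  + by rewrite e eqxx.
Qed.

Lemma swap_Std_content : (`|content T i - content T i1| != 1)%R ->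
  swap T i i1 \in Std la.
Proof. by move=> ne; apply: swap_Std; apply: contra ne => /box_le_adjacent ->. Qed.

End Consecutive.

Definition col_sorted T := forall k k' : 'I_n, k < k' ->
  (T k).2 < (T k').2 \/ (T k).2 = (T k').2 /\ (T k).1 < (T k').1.

(** As long as two consecutive labels are out of column reading order, their boxes are incomparable,
    and exchanging them raises a bounded weight. *)
Lemma col_sorted_ind la (Q : filling n -> Prop) :
  (forall T, T \in Std la -> col_sorted T -> Q T) ->
  (forall T i i1, T \in Std la -> i1 = i.+1 :> nat ->
     (1 < `|content T i - content T i1|)%R ->
     swap T i i1 \in Std la -> Q (swap T i i1) -> Q T) ->
  forall T, T \in Std la -> Q T.
Proof.
move=> Qs Qswap T sT.
(* [code] numbers the boxes column by column; [wt] grows when a larger code moves to a larger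
   label. *)
pose code b := nat_of_ord b.2 * n + nat_of_ord b.1.
pose wt T := \sum_(k < n) k * code (T k).
have wtmax T' : wt T' <= \sum_(k < n) k * (n * n).
  apply: leq_sum => k _; rewrite leq_mul //; case: (T' k) => b1 b2; rewrite /code /=.
  by have := ltn_ord b1; have := ltn_ord b2; nia.
have [d] := ubnP (\sum_(k < n) k * (n * n) - wt T); elim: d T sT => // d IH T sT lt.
case: (boolP [forall i : 'I_n, forall i1 : 'I_n, (i1 == i.+1 :> nat) ==> (code (T i) <= code (T i1))]).
  move=> /forallP all; apply: Qs => // k k' kk'.
  have mono : code (T k) <= code (T k').
    move: kk' => /subnK; move: (k' - k.+1) => e; elim: e k' => [|e IHe] k' ek.
      have /forallP/(_ k')/implyP := all k; apply; apply/eqP; lia.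
    have lt' : e + k.+1 < n by have := ltn_ord k'; lia.
    apply: leq_trans (IHe (Ordinal lt') erefl) _.
    have /forallP/(_ k')/implyP := all (Ordinal lt'); apply; apply/eqP => /=; lia.
  have : T k <> T k' by move=> /(Std_inj sT) e; rewrite e ltnn in kk'.
  move: mono; case: (T k) => r c; case: (T k') => r' c'; rewrite /code /=.
  have := ltn_ord r; have := ltn_ord r' => h1 h2 h3 h4.
  case: (ltngtP c c') => [|h|/val_inj e]; first by left.
    have := leq_mul h (leqnn n); nia.
  right; split => //; case: (ltngtP r r') => // [h|/val_inj e']; first by subst; lia.
  by case: h4; rewrite e e'.
move=> /forallPn[i /forallPn[i1]].
rewrite negb_imply => /andP[/eqP ei]; rewrite -ltnNge => lt'.
have nle : ~~ box_le (T i) (T i1).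
  apply/negP => /andP[l1 l2]; move: lt'; rewrite /code ltnNge.
  by rewrite leq_add ?leq_mul.
have sT' := swap_Std sT ei nle.
apply: (Qswap T i i1) => //; first exact: incomparable_content sT ei nle.
have nii : i1 != i by apply/eqP => e; move: ei; rewrite e; lia.
suff lt2 : wt T < wt (swap T i i1).
  by apply: IH => //; move: lt lt2 (wtmax (swap T i i1)); lia.
rewrite /wt (bigD1 i) //= (bigD1 i1) //= [X in _ < X](bigD1 i) //= [X in _ < _ + X](bigD1 i1) //=.
rewrite !ffunE tpermL tpermR.
rewrite (eq_bigr (fun k : 'I_n => k * code (swap T i i1 k))); last first.
  by move=> k /andP[k1 k2]; rewrite ffunE tpermD // eq_sym.
rewrite !addnA ltn_add2r ei; move: (code _) (code _) lt' => c c'; nia.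
Qed.

End StandardTableaux.

(** * Joint eigenvectors of the Jucys-Murphy elements *)

Local Open Scope ring_scope.

Section JucysMurphy.
Variables (F : numFieldType) (n : nat).
Implicit Types (f : 'S_n -> F) (a : 'I_n -> F) (T : filling n) (g s : 'S_n) (k : 'I_n).

(** A function [f] stands for the element of the group algebra with these coefficients.
    Transpositions being involutions, the sum is the coefficient at [g] of [f] times the k-th
    Jucys-Murphy element. *)
Definition JM_right a f := forall k g,
  \sum_(j < n | (j < k)%N) f (g * tperm j k)%g = a k * f g.

Definition JM_left a f := forall k g,
  \sum_(j < n | (j < k)%N) f (tperm j k * g)%g = a k * f g.

Definition contents T k : F := (content T k)%:~R.

Lemma JM_left_inv a f : JM_right a (fun g => f g^-1%g) -> JM_left a f.
Proof.
move=> h k g; rewrite -[g in RHS]invgK -h; apply: eq_bigr => j _.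
by rewrite invMg tpermV invgK.
Qed.

Section Polytabloid.
Variables (r : 'I_n -> 'I_n) (T : filling n).

Definition col_stab s := [forall y, (T (s y)).2 == (T y).2].
Definition row_match g := [forall x, (T (g x)).1 == r x].

(* The coefficients of a_R w b_C, with a_R the row symmetrizer of a tableau   *)
(* with row labels r, b_C the column antisymmetrizer of T and w the           *)
(* permutation that carries one tableau to the other.                         *)
Definition polytabloid g : F :=
  \sum_(s | col_stab s) (-1) ^+ s * (row_match (g * s)%g)%:R.

Lemma col_stabM s t : col_stab s -> col_stab (s * t)%g = col_stab t.
Proof.
move=> /forallP cs; apply/forallP/forallP => h y.
  have := h (s^-1 y)%g; rewrite permM permKV => /eqP ->.
  by have := cs (s^-1 y)%g; rewrite permKV eq_sym.
by rewrite permM (eqP (h _)) cs.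
Qed.

Lemma col_stabMr s t : col_stab t -> col_stab (s * t)%g = col_stab s.
Proof.
move=> /forallP ct; apply/forallP/forallP => h y.
  by have := h y; rewrite permM (eqP (ct _)).
by rewrite permM (eqP (ct _)) h.
Qed.

Lemma col_stab_tperm i j : (T i).2 = (T j).2 -> col_stab (tperm i j).
Proof. by move=> e; apply/forallP => y; case: tpermP => [->|->|]; rewrite ?e. Qed.

Lemma row_match_tperm g i j : (T i).1 = (T j).1 ->
  row_match (g * tperm i j)%g = row_match g.
Proof.
move=> e; apply: eq_forallb => x; rewrite permM.
by case: tpermP => [->|->|]; rewrite ?e.
Qed.

Lemma polytabloid_col j k g : j != k -> (T j).2 = (T k).2 ->
  polytabloid (g * tperm j k)%g = - polytabloid g.
Proof.
move=> jk e; rewrite /polytabloid (reindex_inj (mulgI (tperm j k))) /= -sumrN.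
rewrite (eq_bigl col_stab) => [|s]; last by rewrite col_stabM // col_stab_tperm.
apply: eq_bigr => s _; rewrite mulgA -[(g * _ * _)%g]mulgA tperm2 mulg1.
by rewrite odd_permM odd_tperm jk signr_addb mulN1r mulNr.
Qed.

Lemma tperm_mulC i j s : (tperm i j * s = s * tperm (s i) (s j))%g.
Proof.
apply/permP => x; rewrite !permM; case: tpermP => [->|->|/eqP n1 /eqP n2].
- by rewrite tpermL.
- by rewrite tpermR.
- by rewrite tpermD // (inj_eq perm_inj) eq_sym.
Qed.

(* Garnir relation: column c is not shorter than that of k. *)
Lemma polytabloid_garnir (la : partn n) (c : 'I_n) k g : T \in Std la ->
  (c < (T k).2)%N ->
  \sum_(j < n | (T j).2 == c) polytabloid (g * tperm j k)%g = polytabloid g.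
Proof.
move=> sT ck.
pose col j := (T j).2 == c.
have -> : \sum_(j < n | col j) polytabloid (g * tperm j k)%g =
    \sum_(s | col_stab s) \sum_(j < n | col j)
      (-1) ^+ s * (row_match (g * s * tperm j (s k))%g)%:R.
  rewrite exchange_big /=; apply: eq_bigr => s /forallP cs.
  rewrite [RHS](reindex_inj (@perm_inj _ s)) /=.
  by apply: eq_big => [j|j _]; rewrite /col ?(eqP (cs j)) // -!mulgA tperm_mulC.
rewrite /polytabloid.
rewrite !(partition_big (fun s : 'S_n => s k) (fun k' => (T k').2 == (T k).2)) /=;
  try by move=> s /forallP.
apply: eq_bigr => k' /eqP ek'.
(* [j0] is the entry of column [c] in the row of [k']. Its transposition with [k'] preserves rows,
   so the term of [j0] gives the right-hand side; the terms of all other [j] have to cancel. *)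
have [j0 _ ej0] : exists2 j0 : 'I_n, (j0 <= k')%N & T j0 = ((T k').1, c).
  by apply: (Std_below sT); rewrite /box_le /= leqnn ek' ssrnat.ltnW.
rewrite exchange_big (bigD1 j0) /=; last by rewrite /col ej0.
rewrite [X in _ + X]big1 ?addr0 => [|j /andP[cj nj]].
  apply: eq_bigr => s /andP[_ /eqP ->]; rewrite row_match_tperm //; by rewrite ej0.
have nk x : col x -> k' != x.
  move=> cx; apply/eqP => e; move: cx; rewrite -e /col ek' => /eqP e'.
  by rewrite e' ltnn in ck.
set Y := \sum_(_ | _) _; suff /eqP : Y = - Y.
  by rewrite -addr_eq0 -mulr2n mulrn_eq0 => /eqP.
have cj0 : col j0 by rewrite /col ej0.
(* Sign-reversing involution: multiplying [s] by the column transposition of [j] and [j0] changes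
   the argument of [row_match] only by the row transposition of [k'] and [j0]. *)
rewrite {1}/Y (reindex_inj (mulIg (tperm j j0))) /= -sumrN.
rewrite (eq_bigl (fun s : 'S_n => col_stab s && (s k == k'))) => [|s]; last first.
  rewrite col_stabMr ?col_stab_tperm ?(eqP cj) ?ej0 //; congr (_ && _).
  rewrite permM; case: tpermP => // -> ;
  by rewrite !(eq_sym _ k') (negPf (nk _ cj0)) (negPf (nk _ cj)).
apply: eq_bigr => s /andP[_ /eqP sk].
rewrite permM sk (tpermD (z := k')) 1?eq_sym ?nk //.
rewrite odd_permM odd_tperm nj addbT signrN mulNr; congr (- (_ * _%:R)).
have -> : (g * (s * tperm j j0) * tperm j k' = g * s * tperm j k' * tperm k' j0)%g.
  by rewrite -!mulgA tperm_mulC tpermL (tpermD nj (nk _ cj0)).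
by rewrite row_match_tperm // ej0.
Qed.

Lemma card_col_above la k : T \in Std la ->
  #|[set j : 'I_n | ((T j).2 == (T k).2) && ((T j).1 < (T k).1)%N]| = (T k).1.
Proof.
move=> sT; rewrite -(card_in_imset (f := fun j => (T j).1)); last first.
  move=> i j; rewrite !inE => /andP[/eqP ei _] /andP[/eqP ej _] e.
  by apply: (Std_inj sT); rewrite [T i]surjective_pairing [T j]surjective_pairing ei ej e.
rewrite -[RHS](card_ltn_ord (ssrnat.ltnW (ltn_ord (T k).1))).
apply: eq_card => i; rewrite inE; apply/imsetP/idP => [[j + ->]|lt].
  by rewrite inE => /andP[].
have [j _ ej] : exists2 j : 'I_n, (j <= k)%N & T j = (i, (T k).2).
  by apply: (Std_below sT); rewrite /box_le /= leqnn ssrnat.ltnW.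
by exists j; rewrite ?inE ej ?eqxx.
Qed.

(** In column order the labels before [k] are those above it in its column, each contributing -1,
    and the full columns to its left, each contributing 1 by the Garnir relation. The total is
    column minus row. *)
Lemma polytabloid_JM la : T \in Std la -> col_sorted T ->
  JM_right (contents T) polytabloid.
Proof.
move=> sT cs k g.
have ltE (j : 'I_n) : (j < k)%N =
    ((T j).2 == (T k).2) && ((T j).1 < (T k).1)%N || ((T j).2 < (T k).2)%N.
  apply/idP/idP => [/cs[->|[-> ->]]|h]; rewrite ?eqxx ?orbT //.
  case: (ltngtP j k) => // [/cs|/val_inj e].
    case/orP: h => [/andP[/eqP e h]|h] [h'|[e' h']]; try lia.
      by rewrite e ltnn in h'.
    by rewrite e' ltnn in h.
  by move: h; rewrite e !ltnn andbF.
rewrite (bigID (fun j => (T j).2 == (T k).2)) /=.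
rewrite (eq_bigl (fun j : 'I_n => ((T j).2 == (T k).2) && ((T j).1 < (T k).1)%N)); last first.
  move=> j; rewrite ltE; case: eqP => [->|] /=; rewrite ?ltnn ?orbF ?andbT ?andbF //.
rewrite (eq_bigr (fun _ => - polytabloid g)); last first.
  move=> j /andP[/eqP e lt]; apply: polytabloid_col => //.
  by apply/eqP => ejk; rewrite ejk ltnn in lt.
rewrite sumr_const -cardsE (card_col_above k sT).
rewrite (eq_bigl (fun j : 'I_n => ((T j).2 < (T k).2)%N)); last first.
  by move=> j; rewrite ltE; case: eqP => [->|] /=; rewrite ?ltnn ?orbF ?andbT ?andbF.
rewrite (partition_big (fun j => (T j).2) (fun c : 'I_n => (c < (T k).2)%N)) //=.
rewrite (eq_bigr (fun _ => polytabloid g)); last first.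
  move=> c ck; rewrite -[RHS](polytabloid_garnir g sT ck); apply: eq_bigl => j.
  by case: eqP => [->|]; rewrite ?ck ?andbF.
rewrite sumr_const -cardsE card_ltn_ord; last exact: ssrnat.ltnW.
by rewrite /contents /content intrB -!pmulrn mulrBl !mulr_natl mulNrn addrC.
Qed.

End Polytabloid.

Definition row_labels T k := (T k).1.

(* Reduces left eigenvectors to right ones. *)
Lemma polytabloid_transpose T T' (w : 'S_n) g : (forall x, T' (w x) = T x) ->
  polytabloid (row_labels T) T' g =
  (-1) ^+ w * (-1) ^+ g *
    polytabloid (row_labels (transpose T')) (transpose T) g^-1%g.
Proof.
move=> ew; rewrite /polytabloid mulr_sumr.
rewrite [LHS]big_mkcond [RHS]big_mkcond /=.
(* The substitution of [g^-1 * s * w] for [s] turns the column condition into a row condition for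
   the transposes, and conversely. *)
rewrite [LHS](reindex_inj (mulgI g^-1%g)) [LHS](reindex_inj (mulIg w)) /=.
apply: eq_bigr => s _.
have -> : col_stab T' (g^-1 * (s * w))%g =
    row_match (row_labels (transpose T')) (transpose T) (g^-1 * s)%g.
  by apply: eq_forallb => x; rewrite /row_labels !ffunE /= mulgA permM ew.
have -> : row_match (row_labels T) T' (g * (g^-1 * (s * w)))%g =
    col_stab (transpose T) s.
  by apply: eq_forallb => x; rewrite /row_labels !ffunE /= mulKVg permM ew.
case: row_match; case: col_stab; rewrite ?mulr0 ?mulr1 //.
rewrite !odd_permM odd_permV.
by move: (odd_perm g) (odd_perm s) (odd_perm w) => b c d; rewrite !signr_addb mulrA mulrC mulrA.
Qed.

End JucysMurphy.

(** * Young's intertwiners and joint eigenvectors for all pairs of tableaux *)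

Section JointEigenvectors.
Variables (F : numFieldType) (n : nat).
Implicit Types (f : 'S_n -> F) (a : 'I_n -> F) (T : filling n) (g s : 'S_n) (k : 'I_n).

Section Intertwiner.
Variables (a : 'I_n -> F) (f : 'S_n -> F) (i i1 : 'I_n).
Hypotheses (fJ : JM_right a f) (ei : i1 = i.+1 :> nat).
Local Notation s := (tperm i i1).

Let nii : i != i1. Proof. by rewrite -val_eqE /= ei ltn_eqF. Qed.

Lemma JM_tperm_other k g : k != i -> k != i1 ->
  \sum_(j < n | (j < k)%N) f (g * tperm j k * s)%g = a k * f (g * s)%g.
Proof.
move=> ki ki1; rewrite -fJ [RHS](reindex_inj (@perm_inj _ s)) /=.
apply: eq_big => [j|j _].
  move: ki ki1; rewrite -!val_eqE /= => ki ki1.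
  by case: tpermP => [->|->|//]; rewrite ei; lia.
by rewrite -!mulgA tperm_mulC (@tpermD _ _ _ k) // eq_sym.
Qed.

Lemma JM_tperm_snd g :
  \sum_(j < n | (j < i1)%N) f (g * tperm j i1 * s)%g = a i * f (g * s)%g + f g.
Proof.
rewrite (bigD1 i) /= ?ei // -mulgA tperm2 mulg1 addrC; congr (_ + _).
rewrite -fJ; apply: eq_big => [j|j].
  by rewrite ltnS ltn_neqAle andbC -val_eqE.
rewrite ltnS => /andP[le ne]; rewrite -!mulgA tperm_mulC tpermR tpermD // 1?eq_sym //.
by rewrite -val_eqE /= ei; apply/eqP; lia.
Qed.

Lemma JM_tperm_fst g :
  \sum_(j < n | (j < i)%N) f (g * tperm j i * s)%g = a i1 * f (g * s)%g - f g.
Proof.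
rewrite -fJ (bigD1 (P := fun j : 'I_n => (j < i1)%N) i) /= ?ei //.
rewrite -mulgA tperm2 mulg1 [RHS]addrC addKr; apply: eq_big => [j|j lt].
  by rewrite ltnS ltn_neqAle andbC -val_eqE.
rewrite -!mulgA tperm_mulC tpermL tpermD // -val_eqE /=; apply/eqP; lia.
Qed.

(** From s J_{i+1} = J_i s + 1 one gets v s J_{i+1} = a_i v s + v; subtracting v / (a_{i+1} - a_i)
    from v s absorbs the extra v. *)
Lemma intertwine : a i1 - a i != 0 ->
  JM_right (fun k => a (s k)) (fun g => f (g * s)%g - (a i1 - a i)^-1 * f g).
Proof.
move=> ne k g; rewrite sumrB -mulr_sumr fJ.
set c := _^-1; have e : c * a i1 * f g = f g + c * a i * f g.
  rewrite -[X in X + _]mul1r -mulrDl; congr (_ * _).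
  by apply/eqP; rewrite -subr_eq -mulrBr mulVf.
have [->|ki] := eqVneq k i.
  rewrite tpermL JM_tperm_fst; apply/eqP; rewrite -subr_eq0.
  by rewrite -[X in _ == X](subrr (c * a i1 * f g)) {2}e; apply/eqP; ring.
have [->|ki1] := eqVneq k i1.
  rewrite tpermR JM_tperm_snd; apply/eqP; rewrite -subr_eq0.
  by rewrite -[X in _ == X](subrr (c * a i1 * f g)) {1}e; apply/eqP; ring.
by rewrite tpermD 1?eq_sym // JM_tperm_other // mulrBr mulrCA.
Qed.

(** If v s = c v, then v = v s s = c^2 v, which forces c^2 = 1. *)
Lemma intertwine_neq0 g : (a i1 - a i) ^+ 2 != 1 -> f g != 0 ->
  exists g', f (g' * s)%g - (a i1 - a i)^-1 * f g' != 0.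
Proof.
move=> ne fg; set c := _^-1.
have [/eqP e1|] := eqVneq (f (g * s)%g - c * f g) 0; last by exists g.
have [/eqP e2|] := eqVneq (f (g * s * s)%g - c * f (g * s)%g) 0; last by exists (g * s)%g.
move: e1 e2; rewrite -mulgA tperm2 mulg1 !subr_eq0 => /eqP -> /eqP e.
case/eqP: ne; move: e; rewrite mulrA -expr2 -[LHS]mul1r => /(mulIf fg) /esym.
by rewrite /c exprVn => /(canRL invrK); rewrite invr1.
Qed.

End Intertwiner.

Definition joint S T f := [/\ exists g, f g != 0,
  JM_left (contents F S) f & JM_right (contents F T) f].

Lemma joint_inv S T f : joint S T f -> joint T S (fun g => f g^-1%g).
Proof.
move=> [[g fg] fL fR]; split; first by exists g^-1%g; rewrite invgK.
  by apply: JM_left_inv => k h; under eq_bigr do rewrite invgK; rewrite invgK fR.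
move=> k h; rewrite -fL; apply: eq_bigr => j _.
by rewrite invMg tpermV.
Qed.

Lemma joint_swap la S T (i i1 : 'I_n) : T \in Std la -> i1 = i.+1 :> nat ->
  (1 < `|content T i - content T i1|)%R ->
  (exists f, joint S (swap T i i1) f) -> exists f, joint S T f.
Proof.
move=> sT ei gt1 [f [[g fg] fL fR]]; set a := contents F (swap T i i1) in fR.
have aE k : a k = contents F T (tperm i i1 k) by rewrite /a /contents content_swap.
have da : a i1 - a i = (content T i - content T i1)%:~R.
  by rewrite !aE tpermL tpermR intrB.
exists (fun g => f (g * tperm i i1)%g - (a i1 - a i)^-1 * f g); split.
- apply: intertwine_neq0 fg; rewrite // da -rmorphXn -[1]/(1%:~R) eqr_int.
  by apply/eqP; move: gt1; lia.
- move=> k h; rewrite sumrB -mulr_sumr fL mulrBr; congr (_ - _); last by rewrite mulrCA.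
  by rewrite -fL; apply: eq_bigr => j _; rewrite mulgA.
have := intertwine fR ei; rewrite da -[0]/(0%:~R) eqr_int => H.
move=> k h; rewrite -[contents F T k]/(contents F T k).
have -> : contents F T k = a (tperm i i1 k) by rewrite aE tpermK.
by rewrite -da in H *; apply: H; apply/eqP; move: gt1; lia.
Qed.

(** The polytabloid is nonzero at the permutation carrying [S] to [T], since only the identity
    preserves both rows and columns. On the left, the sign of the transposition turns the contents
    of [transpose S] into those of [S]. *)
Lemma joint_sorted la S T : S \in Std la -> T \in Std la ->
  col_sorted (transpose S) -> col_sorted T -> exists f, joint S T f.
Proof.
move=> sS sT cS cT.
have /fin_all_exists[w0 ew0] : forall x, exists y, T y = S x.
  move=> x; have [_ im _ _] := StdP _ _ sT.
  by apply/im; apply: Std_diagram sS.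
have w0I : injective w0 by move=> x y /(congr1 T); rewrite !ew0 => /(Std_inj sS).
pose w := perm w0I; have ew x : T (w x) = S x by rewrite permE ew0.
exists (polytabloid F (row_labels S) T); split.
- exists w; rewrite /polytabloid (bigD1 1%g) /=; last first.
    by apply/forallP => y; rewrite perm1.
  rewrite [X in _ + X]big1 ?addr0 => [|s /andP[/forallP cs ns]].
    rewrite odd_perm1 mulg1 expr0 mul1r pnatr_eq0 eqb0 negbK.
    by apply/forallP => x; rewrite ew.
  case: (boolP (row_match _ _ _)) => [/forallP rs|]; last by rewrite mulr0.
  case/eqP: ns; apply/permP => y; rewrite perm1; apply: (Std_inj sT).
  have := rs (w^-1 y)%g; rewrite permM permKV /row_labels -ew permKV => /eqP e1.
  by rewrite [LHS]surjective_pairing [RHS]surjective_pairing e1 (eqP (cs y)).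
- move=> k g; under eq_bigr do rewrite (polytabloid_transpose _ _ ew).
  rewrite (polytabloid_transpose _ _ ew).
  have := polytabloid_JM F (row_labels (transpose T)) (Std_transpose sS) cS k g^-1%g.
  have -> : contents F (transpose S) k = - contents F S k.
    by rewrite /contents /content !ffunE /= -mulrNz opprB.
  move=> e; rewrite [RHS]mulrCA -[_ * polytabloid _ _ _ _]opprK -mulNr -e mulrN -mulNr mulr_sumr.
  apply: eq_bigr => j lt; rewrite odd_permM odd_tperm invMg tpermV.
  have -> : j != k by rewrite -val_eqE /= ltn_eqF.
  by rewrite signrN !mulrN.
- exact: polytabloid_JM sT cT.
Qed.

Lemma joint_exists la S T : S \in Std la -> T \in Std la -> exists f, joint S T f.
Proof.
move=> sS; move: T; apply: (@col_sorted_ind n la (fun T => exists f, joint S T f)) => [T sT cT|T i i1 sT ei gt1 _]; last first.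
  exact: joint_swap sT ei gt1.
(* [S] has to be sorted by rows, hence the column induction on its transpose; inverting group
   elements moves the exchange to the right-hand side. *)
pose Q S' := exists f, joint (transpose S') T f.
rewrite -[S]transposeK -/(Q (transpose S)).
apply: (@col_sorted_ind n (conj_partn la) Q) (Std_transpose sS).
  move=> S' sS' cS'; apply: joint_sorted sT _ cT; rewrite ?transposeK //.
  by have := Std_transpose sS'; rewrite conj_partnK.
move=> S' i i1 sS' ei gt1 _ [f /joint_inv Jf].
have sS'' : transpose S' \in Std la by have := Std_transpose sS'; rewrite conj_partnK.
have gt1' : (1 < `|content (transpose S') i - content (transpose S') i1|)%R.
  by move: gt1; rewrite /content !ffunE /=; lia.
suff [f' /joint_inv Jf'] : exists f', joint T (transpose S') f'.
  by exists (fun g => f' g^-1%g).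
apply: joint_swap sS'' ei gt1' _; exists (fun g => f g^-1%g).
by move: Jf; congr (joint _ _ _); apply/ffunP => k; rewrite !ffunE.
Qed.

End JointEigenvectors.

(** * The spectrum on the regular representation *)

Section JointEigenbasis.
Variables (F : fieldType) (V : lmodType F) (I : finType) (K : Type).
Variables (A : K -> {linear V -> V}) (chi : I -> K -> F) (u : I -> V).
Hypothesis u_neq0 : forall i, u i != 0.
Hypothesis u_eig : forall i k, A k (u i) = chi i k *: u i.
Hypothesis chi_inj : forall i j, i != j -> exists k, chi i k != chi j k.

(** Applying [A k - chi j k] to a relation kills the coefficient of [u j] and multiplies that of
    [u i0] by a nonzero scalar, for suitable [k]; this is repeated over all [j] other than [i0]. *)
Lemma joint_eigenvectors_free (c : I -> F) :
  \sum_i c i *: u i = 0 -> forall i, c i = 0.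
Proof.
move=> c0 i0.
suff H (r : seq I) : i0 \notin r -> exists d c', [/\ d != 0, c' i0 = d * c i0,
    forall j, j \in r -> c' j = 0 & \sum_i c' i *: u i = 0].
  have [|d [c' [nd ec c'0]]] := H [seq i <- enum I | i != i0].
    by rewrite mem_filter eqxx.
  rewrite (bigD1 i0) //= [X in _ + X]big1 ?addr0 => [|j nj].
    by move/eqP; rewrite scaler_eq0 (negPf (u_neq0 _)) orbF ec mulf_eq0 (negPf nd) => /eqP.
  by rewrite c'0 ?scale0r // mem_filter nj mem_enum.
elim: r => [|j r IH].
  by move=> _; exists 1, c; rewrite oner_eq0 mul1r.
rewrite inE negb_or => /andP[nj /IH[d [c' [nd ec c'0 sc']]]].
have [k nk] := chi_inj nj.
exists ((chi i0 k - chi j k) * d), (fun i => (chi i k - chi j k) * c' i); split.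
- by rewrite mulf_neq0 // subr_eq0.
- by rewrite ec mulrA.
- by move=> i; rewrite inE => /predU1P[->|/c'0 ->]; rewrite ?mulr0 // subrr mul0r.
have : A k (\sum_i c' i *: u i) - chi j k *: \sum_i c' i *: u i = 0.
  by rewrite sc' linear0 scaler0 subr0.
rewrite linear_sum scaler_sumr -sumrB => e; rewrite -[RHS]e; apply: eq_bigr => i _.
by rewrite linearZ /= u_eig !scalerA -scalerBl mulrC mulrBr [_ * c' i in RHS]mulrC.
Qed.

End JointEigenbasis.

Lemma rank_diag_mx (F : fieldType) q (v : 'rV[F]_q) :
  \rank (diag_mx v) = #|[set i | v 0 i != 0]|.
Proof.
elim: q v => [|q IH] v.
  by rewrite thinmx0 mxrank0 -sum1dep_card big_ord0.
pose w : 'rV_(1 + q) := v.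
have -> : \rank (diag_mx v) =
    (\rank (diag_mx (lsubmx w)) + \rank (diag_mx (rsubmx w)))%N.
  by rewrite -(@rank_diag_block_mx _ 1 1 q q) -diag_mx_row hsubmxK.
rewrite IH -!sum1dep_card [RHS]big_mkcond big_ord_recl; congr (_ + _)%N.
  rewrite rank_rV; case: ifP => [|/negbT/negPn/eqP] e.
    suff -> : diag_mx (lsubmx w) != 0 by [].
    apply: contraNneq e => /matrixP/(_ 0 0); rewrite !mxE eqxx mulr1n.
    by rewrite (_ : lshift q 0 = 0) //; [move/eqP | apply: val_inj].
  apply/eqP; rewrite eqb0 negbK; apply/eqP/matrixP => i j; rewrite !ord1 !mxE mulr1n.
  by rewrite (_ : lshift q 0 = 0) //; apply: val_inj.
rewrite big_mkcond; apply: eq_bigr => i _; rewrite mxE.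
by rewrite (_ : rshift 1 i = lift ord0 i) //; apply: val_inj.
Qed.

Lemma rank_eigenspace_diag (F : fieldType) q N (B : 'M[F]_(q, N)) (M : 'M_N)
    (d : 'I_q -> F) (x : F) :
  row_free B -> (N <= q)%N -> (forall i, row i B *m M = d i *: row i B) ->
  \rank (eigenspace M x) = #|[set i | d i == x]|.
Proof.
move=> fB Nq eB.
have qN : q = N by apply/eqP; rewrite eqn_leq Nq andbT -(eqP fB) rank_leq_col.
have full : row_full B by rewrite /row_full (eqP fB) qN.
pose D := diag_mx (\row_i (d i - x)).
have eD : B *m (M - x%:M) = D *m B.
  apply/row_matrixP => i; rewrite !row_mul mulmxBr eB mul_mx_scalar -scalerBl.
  by rewrite row_diag_mx -scalemxAl -rowE mxE.
rewrite /eigenspace mxrank_ker -(eqmxMfull _ full) eD mxrankMfree // rank_diag_mx.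
rewrite -[X in (X - _)%N]qN [RHS]cardsCs card_ord; congr (_ - _)%N.
by apply: eq_card => i; rewrite !inE mxE subr_eq0.
Qed.

Lemma regular_mulE (F : fieldType) (gT : finGroupType) (G : {group gT})
    (f : gT -> F) (x : gT) : x \in G ->
  (\row_i f (enum_val i)) *m regular_repr F G x = \row_i f (enum_val i * x^-1)%g.
Proof.
move=> xG; apply/rowP => j; rewrite !mxE.
have jG : (enum_val j * x^-1)%g \in G by rewrite groupM ?groupV ?enum_valP.
rewrite (bigD1 (gring_index G (enum_val j * x^-1)%g)) //= !mxE gring_indexK //.
rewrite mulgKV gring_valK !eqxx mulr1 big1 ?addr0 // => i ni.
rewrite !mxE eqxx /=; case: eqP => [e|_]; last by rewrite mulr0.
case/eqP: ni; apply: enum_val_inj; rewrite gring_indexK // e.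
by rewrite gring_indexK ?mulgK // groupM // enum_valP.
Qed.

(** * Eigenvectors of P from joint eigenvectors *)

Section Eigenvectors.
Variables (F : numFieldType) (m : nat).
Local Notation n := m.+2.
Local Notation p := (penl m).
Local Notation l := (lastl m).
Local Notation s := (tperm p l).
Implicit Types (f : 'S_n -> F) (T : filling n) (g : 'S_n).

Lemma val_penl : p = m :> nat. Proof. by rewrite /penl inordK. Qed.

Lemma lastlE : l = p.+1 :> nat. Proof. by rewrite val_penl. Qed.

Lemma penl_neq_lastl : p != l. Proof. by rewrite -val_eqE /= val_penl ltn_eqF. Qed.

Lemma ltn_penl (i : 'I_n) : (i < m)%N -> (p != i) && (l != i).
Proof. by move=> im; rewrite -!val_eqE /= val_penl !gtn_eqF // ltnW. Qed.

(* Right multiplication by P of the element with coefficients f: the inverse  *)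
(* of cycle3 i j k is cycle3 i k j.                                           *)
Definition Pfun f g := f g + \sum_(i < n | (i < m)%N)
  (f (g * cycle3 i l p)%g + f (g * cycle3 i p l)%g).

Lemma cycle3_penl_lastl (i : 'I_n) : (i < m)%N -> cycle3 i p l = (tperm i l * s)%g.
Proof.
move=> /ltn_penl/andP[pi _]; rewrite /cycle3 tperm_mulC tpermL (tpermC l).
by rewrite tpermD // eq_sym // penl_neq_lastl.
Qed.

Lemma cycle3_lastl_penl (i : 'I_n) : (i < m)%N -> cycle3 i l p = (tperm i p * s)%g.
Proof.
move=> /ltn_penl/andP[_ li]; rewrite /cycle3 tperm_mulC tpermL.
by rewrite tpermD ?penl_neq_lastl // eq_sym.
Qed.

Lemma JM_penl a f g : JM_right a f ->
  \sum_(i < n | (i < m)%N) f (g * tperm i p)%g = a p * f g.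
Proof. by move=> <-; rewrite val_penl. Qed.

Lemma sum_ltn_lastl (E : 'I_n -> F) :
  \sum_(i < n | (i < l)%N) E i = E p + \sum_(i < n | (i < m)%N) E i.
Proof.
rewrite (bigD1 p) /=; last by rewrite val_penl.
congr (_ + _); apply: eq_bigl => i; rewrite -val_eqE /= val_penl ltnS.
by rewrite [in RHS]ltn_neqAle andbC.
Qed.

Lemma JM_lastl a f g : JM_right a f ->
  \sum_(i < n | (i < m)%N) f (g * tperm i l)%g = a l * f g - f (g * s)%g.
Proof. by move=> <-; rewrite sum_ltn_lastl addrC addKr. Qed.

(** Here v P = v s (J_{n-1} + J_n), the identity in P being the product of s with itself. Moving s
    past the two summands produces the corrections -1 and +1, which cancel. *)
Lemma Pfun_JM a f g : JM_right a f -> Pfun f g = (a p + a l) * f (g * s)%g.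
Proof.
move=> fJ; rewrite /Pfun.
under eq_bigr => i im do rewrite cycle3_penl_lastl // cycle3_lastl_penl // !mulgA.
rewrite big_split /=.
have := JM_tperm_snd fJ lastlE g; rewrite sum_ltn_lastl -mulgA tperm2 mulg1.
move=> /(canRL (addKr _)) ->.
have := JM_tperm_fst fJ lastlE g; rewrite val_penl => ->; ring.
Qed.

Lemma Pfun_JM_swap a f g : JM_right a f ->
  Pfun (fun h => f (h * s)%g) g = (a p + a l) * f g.
Proof.
move=> fJ; rewrite /Pfun.
under eq_bigr => i im do rewrite cycle3_penl_lastl // cycle3_lastl_penl //
  !mulgA -![(_ * s * s)%g]mulgA tperm2 !mulg1.
by rewrite big_split /= (JM_penl _ fJ) (JM_lastl _ fJ); ring.
Qed.

Definition sign_last T : int := if content T p < content T l then 1 else -1.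
Definition eval_last T : int := sign_last T * (content T p + content T l).

Lemma sign_last2 T : sign_last T * sign_last T = 1.
Proof. by rewrite /sign_last; case: ifP. Qed.

(** The vector is v + eps v s with eps = [sign_last T]. If it vanished, then v s = -eps v, and
    comparing eigenvalues would give a_n - a_{n-1} = -eps, against the choice of eps. *)
Lemma eigenvector_exists (la : partn n) (S T : filling n) :
    S \in Std la -> T \in Std la ->
  exists u : 'S_n -> F,
  [/\ exists g, u g != 0, JM_left (contents F S) u,
      forall (k : 'I_n) g, (k < m)%N ->
        \sum_(j < n | (j < k)%N) u (g * tperm j k)%g = contents F T k * u g,
      forall g, u (g * s)%g = (sign_last T)%:~R * u g
    & forall g, Pfun u g = (eval_last T)%:~R * u g].
Proof.
move=> sS sT; have [f [[g0 fg0] fL fR]] := joint_exists F sS sT.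
set e : F := (sign_last T)%:~R.
have ee : e * e = 1 by rewrite -rmorphM sign_last2.
exists (fun g => f g + e * f (g * s)%g); split.
- case: (eqVneq (f g0 + e * f (g0 * s)%g) 0) => [e0|]; last by exists g0.
  case: (boolP [forall g, f g + e * f (g * s)%g == 0]); last first.
    by case/forallPn => g ng; exists g.
  move=> /forallP all; exfalso.
  have fs g : f (g * s)%g = - e * f g.
    have := all g; rewrite addr_eq0 => /eqP ->.
    by rewrite mulrN mulNr opprK mulrA ee mul1r.
  have := JM_tperm_fst fR lastlE g0; under eq_bigr do rewrite fs.
  rewrite -mulr_sumr fR fs => h.
  have : (- e * contents F T p) * f g0 = (- e * contents F T l - 1) * f g0.
    by rewrite -mulrA h; ring.
  move/(mulIf fg0); rewrite /e /contents -!mulrNz -[X in _ - X]/(1%:~R) -!rmorphM -rmorphB.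
  move/eqP; rewrite eqr_int /sign_last; case: ifP => lt /eqP; lia.
- move=> k g; rewrite mulrDr big_split -fL /= -mulr_sumr; congr (_ + _).
  rewrite mulrCA -fL; congr (_ * _).
  by apply: eq_bigr => j _; rewrite mulgA.
- move=> k g km; rewrite mulrDr big_split /= fR -mulr_sumr; congr (_ + _).
  have /andP[pk lk] := ltn_penl km.
  by rewrite (JM_tperm_other fR lastlE) 1?eq_sym // mulrCA.
- by move=> g; rewrite -mulgA tperm2 mulg1 mulrDr mulrA ee mul1r addrC.
move=> g.
have -> : Pfun (fun g => f g + e * f (g * s)%g) g = Pfun f g + e * Pfun (fun h => f (h * s)%g) g.
  rewrite /Pfun mulrDr mulr_sumr addrACA -big_split; congr (_ + _).
  by apply: eq_bigr => i _; rewrite /= mulrDr addrACA.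
rewrite (Pfun_JM _ fR) (Pfun_JM_swap _ fR) rmorphM rmorphD /= -/e -!/(contents F T _).
by rewrite mulrDr -[X in _ = _ + X]mulrA (mulrCA _ e) (mulrA e e) ee mul1r; ring.
Qed.

Lemma Pmx_mulE f : (\row_i f (enum_val i)) *m Pmx m F = \row_i Pfun f (enum_val i).
Proof.
have c3 (i : 'I_n) : (i < m)%N ->
    cycle3 i p l \in ('Alt_('I_n))%g /\ cycle3 i l p \in ('Alt_('I_n))%g.
  move=> /ltn_penl/andP[pi li].
  by rewrite !Alt_even !odd_permM !odd_tperm ![i == _]eq_sym pi li.
rewrite /Pmx mulmxDr repr_mx1 mulmx1 mulmx_sumr; apply/rowP => j.
rewrite !mxE /Pfun summxE; congr (_ + _); apply: eq_bigr => i /c3[c1 c2].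
rewrite mulmxDr !regular_mulE // !mxE.
by congr (f (_ * _)%g + f (_ * _)%g); rewrite /cycle3 invMg !tpermV.
Qed.

Lemma Pfun_mull f h g : Pfun (fun g => f (h * g)%g) g = Pfun f (h * g)%g.
Proof. by rewrite /Pfun; congr (_ + _); apply: eq_bigr => i _; rewrite !mulgA. Qed.

Lemma rank_eigenspace_dup N (P : 'M[F]_N) (x : F) :
  \rank (eigenspace (block_mx P 0 0 P) x) = (2 * \rank (eigenspace P x))%N.
Proof.
rewrite /eigenspace !mxrank_ker scalar_mx_block opp_block_mx add_block_mx.
rewrite !oppr0 !addr0 rank_diag_block_mx; move: (\rank _) => r; lia.
Qed.

End Eigenvectors.

Lemma Std_partn n (la la' : partn n) T : T \in Std la -> T \in Std la' -> la = la'.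
Proof.
move=> /StdP[_ im _ _] /StdP[_ im' _ _]; apply/val_inj/ffunP => i; apply/val_inj => /=.
have rowE (mu : partn n) : mu i = #|[set j : 'I_n | (i, j) \in diagram mu]| :> nat.
  rewrite -[LHS](@card_ltn_ord n (mu i)); last by rewrite -ltnS.
  by apply: eq_card => j; rewrite !inE.
rewrite -/(parts _) -/(parts la') !rowE; apply: eq_card => j; rewrite !inE.
by have := im (i, j); have := im' (i, j); rewrite !inE => e e'; apply/idP/idP; tauto.
Qed.

Section Spectrum.
Variables (F : numFieldType) (m : nat).
Local Notation n := m.+2.
Local Notation p := (penl m).
Local Notation l := (lastl m).
Local Notation s := (tperm p l).
Implicit Types (T : filling n).

Lemma labelP (k : 'I_n) : [\/ (k < m)%N, k = p | k = l].
Proof.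
case: (ltngtP k m) => [|lt|e]; [by constructor 1| |]; last first.
  by constructor 2; apply: val_inj; rewrite /= val_penl.
by constructor 3; apply: val_inj => /=; have := ltn_ord k; lia.
Qed.

(** The contents fix the first n-2 boxes, hence the set of the last two; the sign tells which of
    these is filled last. *)
Lemma Std_eq_upto (la : partn n) T T' : T \in Std la -> T' \in Std la ->
  (forall k : 'I_n, (k < m)%N -> content T k = content T' k) ->
  sign_last T = sign_last T' -> T = T'.
Proof.
move=> sT sT' e es.
have eT (k : 'I_n) : (k < m)%N -> T k = T' k := content_prefix sT sT' e (k := k).
have [inj im _ _] := StdP _ _ sT; have [inj' im' _ _] := StdP _ _ sT'.
have mem (k : 'I_n) : (m <= k)%N -> T k = T' p \/ T k = T' l.
  move=> mk; have [k' ek'] : exists k', T' k' = T k by apply/im'/im; exists k.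
  case: (labelP k') => [lt|<-|<-]; [|by left|by right].
  by move: ek'; rewrite -eT // => /inj ekk; rewrite -ekk leqNgt lt in mk.
have npl : T p <> T l by move/inj/eqP; rewrite (negPf (penl_neq_lastl m)).
have [|ep|ep] := mem p; first by rewrite val_penl.
- have [|el|el] := mem l; first by rewrite lastlE val_penl.
    by case: npl; rewrite ep el.
  by apply/ffunP => k; case: (labelP k) => [/eT|->|->].
- have [|el|el] := mem l; first by rewrite lastlE val_penl.
    have /eqP := content_consecutive sT (lastlE m).
    by move: es; rewrite /sign_last /content ep el; case: ifP; case: ifP => //; lia.
  by case: npl; rewrite ep el.
Qed.

(** A common form for the left and right Jucys-Murphy elements and right multiplication by s. *)
Definition pull_sum (r : seq ('S_n -> 'S_n)) (f : {ffun 'S_n -> F^o}) :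
  {ffun 'S_n -> F^o} := [ffun g => \sum_(h <- r) f (h g)].

Lemma pull_sum_linear r : linear (pull_sum r).
Proof.
move=> a f f'; apply/ffunP => g; rewrite !ffunE scaler_sumr -big_split.
by apply: eq_bigr => h _; rewrite !ffunE.
Qed.

HB.instance Definition _ r :=
  GRing.isLinear.Build F {ffun 'S_n -> F^o} {ffun 'S_n -> F^o} _ (pull_sum r)
    (pull_sum_linear r).

Lemma spectrum (x : int) :
  (2 * \rank (eigenspace (Pmx m F) x%:~R) =
   #|[set q in std_pair n | eval_last q.2 == x]|)%N.
Proof.
pose q := #|std_pair n|; pose N := #|('Alt_('I_n))%g|.
have STP (i : 'I_q) : exists2 la,
    (enum_val i).1 \in Std la & (enum_val i).2 \in Std la.
  have := enum_valP i; rewrite inE => /existsP[la /andP[h1 h2]]; by exists la.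
have /fin_all_exists[u0 u0P] (i : 'I_q) : exists u : 'S_n -> F,
  [/\ exists g, u g != 0, JM_left (contents F (enum_val i).1) u,
      forall (k : 'I_n) g, (k < m)%N -> \sum_(j < n | (j < k)%N) u (g * tperm j k)%g =
         contents F (enum_val i).2 k * u g,
      forall g, u (g * s)%g = (sign_last (enum_val i).2)%:~R * u g
    & forall g, Pfun u g = (eval_last (enum_val i).2)%:~R * u g].
  by have [la] := STP i; apply: eigenvector_exists.
pose u i : {ffun 'S_n -> F^o} := [ffun g => u0 i g].
have uE i : u i =1 u0 i by move=> g; rewrite ffunE.
pose lt_seq (k : 'I_n) := [seq j : 'I_n <- enum 'I_n | (j < k)%N].
have lt_seqE (k : 'I_n) (E : 'I_n -> F) :
    \sum_(j <- lt_seq k) E j = \sum_(j < n | (j < k)%N) E j.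
  by rewrite big_filter big_enum_cond.
have lemn : (m <= n)%N by lia.
pose up (k : 'I_m) : 'I_n := widen_ord lemn k.
pose K := ('I_n + 'I_m + unit)%type.
pose maps (k : K) : seq ('S_n -> 'S_n) := match k with
  | inl (inl k) => [seq (fun g => tperm j k * g)%g | j <- lt_seq k]
  | inl (inr k) => [seq (fun g => g * tperm j (up k))%g | j <- lt_seq (up k)]
  | inr _ => [:: fun g => g * s]%g end.
pose chi (i : 'I_q) (k : K) : F := match k with
  | inl (inl k) => contents F (enum_val i).1 k
  | inl (inr k) => contents F (enum_val i).2 (up k)
  | inr _ => (sign_last (enum_val i).2)%:~R end.
have u_neq0 i : u i != 0.
  have [[g ng] _ _ _ _] := u0P i; apply: contra_neq ng => /ffunP/(_ g).
  by rewrite !ffunE.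
have u_eig i k : pull_sum (maps k) (u i) = chi i k *: u i.
  have [_ uL uR us _] := u0P i; apply/ffunP => g; rewrite !ffunE.
  case: k => [[k|k]|[]] /=.
  - by rewrite big_map lt_seqE -[RHS]uL; apply: eq_bigr => j _; rewrite ffunE.
  - rewrite big_map lt_seqE -[RHS]uR; last exact: (ltn_ord k).
    by apply: eq_bigr => j _; rewrite ffunE.
  - by rewrite big_seq1 ffunE us.
have chi_inj i j : i != j -> exists k, chi i k != chi j k.
  move=> nij; apply/existsP; apply: contraR nij => /existsPn h.
  have {}h k : chi i k = chi j k by apply/eqP; have := h k; rewrite negbK.
  have [la S1 T1] := STP i; have [la' S2 T2] := STP j.
  have eS : (enum_val i).1 = (enum_val j).1.
    apply/ffunP => k; apply: (content_prefix (d := n) S1 S2) => // k' _.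
    by have /eqP := h (inl (inl k')); rewrite eqr_int => /eqP.
  have ela : la' = la by apply: Std_partn S2 _; rewrite -eS.
  subst la'; apply/eqP/enum_val_inj.
  rewrite [LHS]surjective_pairing [RHS]surjective_pairing eS; congr (_, _).
  apply: (Std_eq_upto T1 T2) => [k km|]; last first.
    by have /eqP := h (inr tt); rewrite eqr_int => /eqP.
  have /eqP := h (inl (inr (Ordinal km))); rewrite eqr_int => /eqP.
  by rewrite (_ : up _ = k) //; apply: val_inj.
(* The restrictions of [u i] to A_n and to its other coset; P acts on both by the same matrix,
   whence the factor 2. *)
pose R1 i : 'rV[F]_N := \row_a u i (enum_val a).
pose R2 i : 'rV[F]_N := \row_a u i (s * enum_val a)%g.
pose B : 'M_(q, N + N) := \matrix_i row_mx (R1 i) (R2 i).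
have odd_s : odd_perm s by rewrite odd_tperm penl_neq_lastl.
have freeB : row_free B.
  apply: inj_row_free => v vB; apply/rowP => i; rewrite mxE.
  apply: (joint_eigenvectors_free (A := fun k => pull_sum (maps k)) u_neq0 u_eig chi_inj
    (c := fun i => v 0 i)).
  have vBE c : \sum_i v 0 i * B i c = 0 by have := congr1 (fun w : 'rV_(N + N) => w 0 c) vB; rewrite !mxE.
  apply/ffunP => g; rewrite sum_ffunE ffunE.
  case: (boolP (odd_perm g)) => og.
    have sg : (s * g)%g \in ('Alt_('I_n))%g by rewrite Alt_even odd_permM odd_s og.
    rewrite -[RHS](vBE (rshift N (enum_rank_in sg (s * g)%g))); apply: eq_bigr => j _.
    by rewrite mxE row_mxEr mxE enum_rankK_in // mulgA tperm2 mul1g !ffunE.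
  have ag : g \in ('Alt_('I_n))%g by rewrite Alt_even.
  rewrite -[RHS](vBE (lshift N (enum_rank_in ag g))); apply: eq_bigr => j _.
  by rewrite mxE row_mxEl mxE enum_rankK_in // !ffunE.
have leN : (N + N <= q)%N.
  by rewrite addnn -mul2n card_Alt ?card_ord //; apply: fact_le_std_pairs.
have rowB i : row i B *m block_mx (Pmx m F) 0 0 (Pmx m F) =
    (eval_last (enum_val i).2)%:~R *: row i B.
  have [_ _ _ _ uP] := u0P i.
  rewrite rowK mul_row_block !mulmx0 addr0 add0r scale_row_mx.
  have uP' h : (\row_a u i (h * enum_val a)%g) *m Pmx m F =
      (eval_last (enum_val i).2)%:~R *: \row_a u i (h * enum_val a)%g.
    rewrite (Pmx_mulE (fun g => u i (h * g)%g)); apply/rowP => a; rewrite !mxE.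
    rewrite (Pfun_mull (u i)) [u i _ in RHS]uE -uP /Pfun uE; congr (_ + _).
    by apply: eq_bigr => k _; rewrite !uE.
  congr row_mx; last exact: uP'.
  have <- : \row_a u i (1 * enum_val a)%g = R1 i by apply/rowP => a; rewrite !mxE mul1g.
  exact: uP'.
rewrite -rank_eigenspace_dup (rank_eigenspace_diag _ freeB leN rowB).
rewrite -sum1dep_card -[RHS]sum1_card.
rewrite [RHS](eq_bigl (fun q => (q \in std_pair n) && (eval_last q.2 == x))); last first.
  by move=> y; rewrite inE.
by rewrite big_enum_val_cond; apply: eq_bigl => i; rewrite eqr_int.
Qed.
End Spectrum.

(** * Upper standard tableaux *)

Local Close Scope ring_scope.

Section UpperCount.
Variable m : nat.
Local Notation n := m.+2.
Local Notation p := (penl m).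
Local Notation l := (lastl m).
Implicit Types (T : filling n) (la mu : partn n) (x : int).

Lemma Std_first la T : T \in Std la -> T 0%R = (0%R, 0%R).
Proof.
move=> sT; have [k] : exists2 k : 'I_n, k <= (0%R : 'I_n) & T k = (0%R, 0%R).
  by apply: Std_below sT _; rewrite /box_le.
by rewrite leqn0 => /eqP k0 <-; congr (T _); apply: val_inj.
Qed.

Lemma content_second la T : T \in Std la ->
  (content T 0 = 0 /\ `|content T (inord 1)| = 1)%R.
Proof.
move=> sT; have T0 := Std_first sT.
have e1 : (inord 1 : 'I_n) = (0%R : 'I_n).+1 :> nat by rewrite inordK.
have c0 : (content T 0 = 0)%R by rewrite /content T0.
have := box_le_adjacent sT e1; rewrite c0 sub0r normrN => -> //.
by rewrite T0 /box_le.
Qed.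

Lemma content_transpose T k : (content (transpose T) k = - content T k)%R.
Proof. by rewrite /content !ffunE /= opprB. Qed.

(** Transposing negates the sum of the last two contents and also, as these differ, the sign. *)
Lemma eval_last_transpose la T : T \in Std la ->
  eval_last (transpose T) = eval_last T.
Proof.
move=> sT; have := content_consecutive sT (lastlE m).
rewrite /eval_last /sign_last !content_transpose => /eqP ne.
by case: ifP; case: ifP; lia.
Qed.

Definition num_Std la x := #|[set T in Std la | eval_last T == x]|.
Definition num_UStd la x := #|[set T in UStd la | eval_last T == x]|.

(** The label 2 has content 1 or -1, so the tableaux that are not upper are the transposes of the
    upper ones of conjugate shape. *)
Lemma num_Std_UStd la x :
  num_Std la x = num_UStd la x + num_UStd (conj_partn la) x.
Proof.
rewrite /num_Std -(cardsID (UStd la)); congr (_ + _).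
  by apply: eq_card => T; rewrite !inE; case: is_standard => //=; rewrite andbC.
rewrite /num_UStd -(card_imset _ (can_inj (@transposeK n))).
apply: eq_card => T; rewrite inE; apply/imsetP/idP => [[T']|].
  rewrite in_setD => /andP[nU]; rewrite in_set => /andP[sT ev] ->.
  rewrite inE content_transpose (Std_transpose sT) (eval_last_transpose sT) ev andbT /=.
  have n1 : content T' (inord 1) != 1%R by apply: contra nU => c1; rewrite inE sT.
  by have [_] := content_second sT; move/eqP: n1; lia.
rewrite [T \in UStd _]inE => /andP[/andP[sT /eqP c1] ev].
have sT' : transpose T \in Std la by have := Std_transpose sT; rewrite conj_partnK.
exists (transpose T); rewrite ?transposeK //.
rewrite in_setD !in_set -[is_standard la _]in_set -/(Std la) sT' /=.
by rewrite content_transpose c1 (eval_last_transpose sT).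
Qed.

Lemma card_std_pair_eval x :
  #|[set q in std_pair n | eval_last q.2 == x]| = \sum_la nstd la * num_Std la x.
Proof.
pose E la (q : filling n * filling n) : nat :=
  (q.1 \in Std la) * ((q.2 \in Std la) && (eval_last q.2 == x)).
transitivity (\sum_q \sum_la E la q).
  rewrite -sum1dep_card big_mkcond; apply: eq_bigr => q _.
  rewrite inE; case: existsP => [[la /andP[s1 s2]]|nq] /=.
    rewrite (bigD1 la) //= big1 ?addn0 => [|la' nla].
      by rewrite /E s1 s2 /=; case: eqP.
    rewrite /E; case: (boolP (q.1 \in Std la')) => // s1'.
    by case/eqP: nla; exact: Std_partn s1' s1.
  rewrite big1 // => la _; rewrite /E.
  case: (boolP (q.1 \in Std la)) => // s1; case: (boolP (q.2 \in Std la)) => // s2.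
  by case: nq; exists la; rewrite s1.
rewrite exchange_big; apply: eq_bigr => la _ /=.
rewrite -(pair_big xpredT xpredT (fun S T => E la (S, T))) /=.
rewrite /nstd /num_Std -[#|Std la|]sum1_card -sum1dep_card big_distrl [RHS]big_mkcond /=.
apply: eq_bigr => S _; rewrite /E /=; case: (S \in Std la); last by rewrite big1.
rewrite mul1n [RHS]big_mkcond; apply: eq_bigr => T _; rewrite mul1n.
by case: (_ && _).
Qed.


Lemma sum_nstd_num_Std x :
  \sum_la nstd la * num_Std la x = 2 * \sum_la nstd la * num_UStd la x.
Proof.
under eq_bigr do rewrite num_Std_UStd mulnDr.
rewrite big_split mul2n -addnn /=; congr (_ + _).
rewrite [RHS](reindex_inj (inv_inj (@conj_partnK n))).
by apply: eq_bigr => la _; rewrite nstd_conj.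
Qed.

Definition adjacent_last T : bool := (`|content T p - content T l| == 1)%R.

Let swap_last T : filling n := swap T p l.

Lemma content_swap_last T :
  content (swap_last T) p = content T l /\ content (swap_last T) l = content T p.
Proof. by rewrite !content_swap tpermL tpermR. Qed.

(** For n > 3 the label 2 is not moved; for n = 2 the last two boxes are always adjacent. *)
Lemma swap_last_UStd mu T : m != 1 -> T \in UStd mu -> ~~ adjacent_last T ->
  swap_last T \in UStd mu.
Proof.
move=> m1; rewrite !inE => /andP[sT c1] adj.
have sT' : T \in Std mu by rewrite inE.
have := swap_Std_content sT' (lastlE m) adj; rewrite inE => -> /=.
have [m0|m2] : m = 0 \/ 1 < m by lia.
  case/negP: adj; have [c0 _] := content_second sT'.
  have ep : p = 0%R by apply: val_inj; rewrite /= val_penl m0.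
  have el : l = inord 1 by apply: val_inj; rewrite /= m0 inordK.
  by rewrite /adjacent_last ep el c0 (eqP c1).
rewrite content_swap tpermD // -val_eqE /= ?val_penl inordK //; lia.
Qed.

(** The exceptional tableau for n = 3, of shape (2,1): exchanging its last two labels makes the
    content of the label 2 equal to -1. *)
Lemma content_penl_lastl mu T : m = 1 -> T \in UStd mu -> ~~ adjacent_last T ->
  (content T p = 1 /\ content T l = -1)%R.
Proof.
move=> m1; rewrite inE => /andP[sT /eqP c1] adj.
have ep : inord 1 = p by apply: val_inj; rewrite /= val_penl inordK ?m1.
have sT' := swap_Std_content sT (lastlE m) adj.
have [_] := content_second sT'; rewrite ep content_swap tpermL => c2.
have /eqP := content_consecutive sT (lastlE m); rewrite -ep c1; split=> //; lia.
Qed.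

Lemma swap_lastK : involutive swap_last.
Proof. by move=> T; apply: swapK. Qed.

Lemma swap_last_UStdE mu T : m != 1 ->
  (swap_last T \in UStd mu) && ~~ adjacent_last (swap_last T) =
  (T \in UStd mu) && ~~ adjacent_last T.
Proof.
have adjE T' : adjacent_last (swap_last T') = adjacent_last T'.
  by have [e1 e2] := content_swap_last T'; rewrite /adjacent_last e1 e2 distrC.
move=> m1; rewrite adjE; case: (boolP (adjacent_last T)) => adj; rewrite ?andbF ?andbT //.
apply/idP/idP => [h|h]; last exact: swap_last_UStd.
by rewrite -[T]swap_lastK; apply: swap_last_UStd; rewrite ?adjE.
Qed.

(** An adjacent tableau gives the same single value on both sides. The others pair up under the
    exchange of the last two labels, with equal sums and opposite signs, and [evals] lists both
    values at the partner with a_{n-1} < a_n. The exceptional tableau for n = 3 has [eval_last] 0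
    and an empty list. *)
Lemma num_UStd_evals mu x : (m = 1 -> x <> 0%R) ->
  num_UStd mu x = \sum_(T in UStd mu) count_mem x (evals T).
Proof.
move=> x0; have -> : num_UStd mu x = \sum_(T in UStd mu) (eval_last T == x).
  rewrite /num_UStd -sum1dep_card big_mkcondr; apply: eq_bigr => T _.
  by case: eqP.
rewrite (bigID adjacent_last) [RHS](bigID adjacent_last) /=; congr (_ + _).
  apply: eq_bigr => T /andP[_ /eqP adj].
  rewrite /evals -/p -/l /eval_last /sign_last.
  case: (content T l =P content T p + 1)%R => [e|ne] /=.
    rewrite e ltrDl ltr01 addn0; congr (nat_of_bool (_ == _)); lia.
  have e : (content T l = content T p - 1)%R by lia.
  rewrite e eqxx /= ltrBrDl gtrDr ltr10 addn0; congr (nat_of_bool (_ == _)); lia.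
have [m1|m1] := eqVneq m 1.
  rewrite big1 => [|T /andP[sT adj]].
    rewrite big1 // => T /andP[sT adj]; have [e1 e2] := content_penl_lastl m1 sT adj.
    by rewrite /evals -/p -/l e1 e2.
  have [e1 e2] := content_penl_lastl m1 sT adj.
  by rewrite /eval_last e1 e2 subrr mulr0; case: eqP => // /esym/(x0 m1).
pose lt T := (content T p < content T l)%R.
rewrite (bigID lt) [RHS](bigID lt) /=.
have -> : \sum_(T | (T \in UStd mu) && ~~ adjacent_last T && ~~ lt T) (eval_last T == x) =
    \sum_(T | (T \in UStd mu) && ~~ adjacent_last T && lt T)
      (- (content T l + content T p) == x)%R.
  rewrite (reindex_inj (inv_inj swap_lastK)).
  apply: eq_big => [T|T].
    rewrite swap_last_UStdE //.
    case: (boolP ((T \in UStd mu) && ~~ adjacent_last T)) => // /andP[sT _] /=.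
    have [e1 e2] := content_swap_last T; rewrite /lt e1 e2 -leNgt le_eqVlt.
    have sT' : T \in Std mu by move: sT; rewrite inE => /andP[].
    by rewrite (negPf (content_consecutive sT' (lastlE m))).
  have [e1 e2] := content_swap_last T; rewrite /lt /eval_last /sign_last e1 e2.
  by case/andP=> _ /negPf ->; rewrite mulN1r.
rewrite [X in _ = _ + X]big1 ?addn0 => [|T /andP[/andP[_ adj]]]; last first.
  rewrite /lt /evals -/p -/l => /negPf ->.
  case: (content T l =P _) => [e|_]; first by case/eqP: adj; lia.
  by case: (content T l =P _) => [e|_]; first by case/eqP: adj; lia.
rewrite -big_split /=; apply: eq_bigr => T /andP[/andP[_ /eqP adj] lT].
rewrite /eval_last /sign_last /evals -/p -/l -/(lt T) lT.
case: (content T l =P _) => [e|_]; first by case: adj; lia.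
case: (content T l =P _) => [e|_]; first by case: adj; lia.
by rewrite /= addn0 mul1r [(content T p + _)%R]addrC.
Qed.

Lemma rank_eigenspace_Pmx (F : numFieldType) x : (m = 1 -> x <> 0%R) ->
  \rank (eigenspace (Pmx m F) x%:~R) =
    \sum_(mu : partn n) \sum_(T in UStd mu) nstd mu * count_mem x (evals T).
Proof.
move=> x0; apply/eqP; rewrite -(eqn_pmul2l (isT : 0 < 2)); apply/eqP.
rewrite spectrum card_std_pair_eval sum_nstd_num_Std; congr (2 * _).
by apply: eq_bigr => mu _; rewrite num_UStd_evals // big_distrr.
Qed.

(** For n = 3 only adjacent tableaux provide values, and these are odd. *)
Lemma evals_neq0 mu T x : T \in UStd mu -> x \in evals T -> m = 1 -> x <> 0%R.
Proof.
move=> sT xT m1; case: (boolP (adjacent_last T)) => [/eqP adj|nadj]; last first.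
  have [e1 e2] := content_penl_lastl m1 sT nadj.
  by move: xT; rewrite /evals -/p -/l e1 e2.
move: xT; rewrite /evals -/p -/l; case: (content T l =P _) => [e|ne].
  by rewrite inE => /eqP ->; lia.
have e : (content T l = content T p - 1)%R by lia.
by rewrite e eqxx inE => /eqP ->; lia.
Qed.

(** The term of [T] in the multiplicity formula is positive, [T] itself showing that d_mu is
    nonzero. *)
Lemma eigenvalue_Pmx (F : numFieldType) mu T x :
  T \in UStd mu -> x \in evals T -> eigenvalue (Pmx m F) x%:~R%R.
Proof.
move=> sT xT; rewrite /eigenvalue -mxrank_eq0 -lt0n.
rewrite (rank_eigenspace_Pmx _ (evals_neq0 sT xT)).
rewrite (bigD1 mu) //= (bigD1 T) //= -addnA addn_gt0 muln_gt0.
rewrite -has_count has_pred1 xT andbT; apply/orP; left.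
apply/card_gt0P; exists T; by move: sT; rewrite inE => /andP[].
Qed.

End UpperCount.

Local Open Scope ring_scope.

Theorem corollary2p6 (R : realType) (m : nat) (la : partn m.+2)
    (T : filling m.+2) (hT : T \in UStd la :|: UStd (conj_partn la)) :
  let P := Pmx m R[i] in
  let a := content T (lastl m) in
  let b := content T (penl m) in
  [/\ a = b + 1 -> eigenvalue P (2 * a - 1)%:~R,
      a = b - 1 -> eigenvalue P (- (2 * a + 1))%:~R,
      a != b + 1 -> a != b - 1 -> b < a ->
        eigenvalue P (a + b)%:~R /\ eigenvalue P (- (a + b))%:~R
    & (* an eigenvalue has multiplicity d_mu for each time that it is
         provided by an upper standard tableau of size n, of shape mu *)
      forall x : int, x \in evals T ->
        \rank (eigenspace P x%:~R) =
          (\sum_(mu : partn m.+2) \sum_(S in UStd mu)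
             nstd mu * count_mem x (evals S))%N].
Proof.
have [mu sT] : exists mu, T \in UStd mu.
  by case/setUP: hT => h; [exists la | exists (conj_partn la)].
move=> P a b; have ev x : x \in evals T -> eigenvalue P x%:~R := eigenvalue_Pmx _ sT.
split.
- by move=> e; apply: ev; rewrite /evals -/a -/b e eqxx mem_head.
- move=> e; apply: ev; rewrite /evals -/a -/b e eqxx ifF ?mem_head //.
  by apply/eqP; lia.
- move=> /negPf n1 /negPf n2 lt.
  by split; apply: ev; rewrite /evals -/a -/b n1 n2 lt !inE eqxx ?orbT.
- by move=> x xT; apply: rank_eigenspace_Pmx; apply: evals_neq0 sT xT.
Qed.
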